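(* Let $k$ be an algebraically closed field of characteristic $p\ge 7$, and for $\lambda\in k\smallsetminus\{0,1\}$ let $H_\lambda$ be the genus-$4$ hyperelliptic curve $y^2=x(x^4-1)(x^4-\lambda)$ over $k$. For $\lambda_1,\lambda_2\in k\smallsetminus\{0,1\}$, the curve $H_{\lambda_1}$ is isomorphic to the curve $H_{\lambda_2}$ if and only if $\lambda_1=\lambda_2$ or $\lambda_1=1/\lambda_2$.
   Context: Curves are non-singular projective and isomorphisms are over the algebraically closed field $k$. *)

(* Defs.v *)
From HB Require Import structures.
From mathcomp Require Import all_boot all_order all_algebra.
From mathcomp Require Import mpoly.

Set Implicit Arguments.
Unset Strict Implicit.
Unset Printing Implicit Defensive.

Import GRing.Theory.

Local Open Scope ring_scope.

(* Varieties are taken in the classical sense (sets of k-points), which is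
   appropriate because they are only used over an algebraically closed k. *)

(* P^n over k is the set of lines through the origin of k^(n+1). *)
Definition proj_space (k : fieldType) (n : nat) : Type :=
  {L : {vspace 'rV[k]_n.+1} | \dim L == 1%N}.

(* Such a v is automatically nonzero, since P has dimension 1. *)
Definition hcoords (k : fieldType) (n : nat) (P : proj_space k n)
    (v : 'rV[k]_n.+1) : Prop :=
  val P = <[v]>%VS.

Definition vanishes_at (k : fieldType) (n : nat) (F : {mpoly k[n.+1]})
    (P : proj_space k n) : Prop :=
  forall v, hcoords P v -> F.@[v 0] = 0.

(* Zariski closure in P^n. *)
Definition proj_closure (k : fieldType) (n : nat)
    (X : proj_space k n -> Prop) : proj_space k n -> Prop :=
  fun P => forall (d : nat) (F : {mpoly k[n.+1]}),
    F \is d.-homog -> (forall Q, X Q -> vanishes_at F Q) -> vanishes_at F P.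

Definition mpoly_map (k : fieldType) (n m : nat)
    (F : 'I_m.+1 -> {mpoly k[n.+1]}) (v : 'rV[k]_n.+1) : 'rV[k]_m.+1 :=
  \row_j (F j).@[v 0].

(* phi is a morphism on X: around each point P of X it is given by forms
   F_0, ..., F_m of a common degree that do not all vanish at P.  The values
   of phi outside X are irrelevant.  Requiring agreement on the whole locus of
   X where F is nonzero, and not just on some neighbourhood of P, costs nothing:
   multiply the F_j by a form that vanishes outside the neighbourhood but not
   at P. *)
Definition regular_on (k : fieldType) (n m : nat) (X : proj_space k n -> Prop)
    (phi : proj_space k n -> proj_space k m) : Prop :=
  forall P, X P ->
  exists (d : nat) (F : 'I_m.+1 -> {mpoly k[n.+1]}),
    [/\ forall j, F j \is d.-homog,
        exists2 v, hcoords P v & mpoly_map F v != 0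
      & forall Q v, X Q -> hcoords Q v -> mpoly_map F v != 0 ->
          hcoords (phi Q) (mpoly_map F v)].

Definition isomorphic (k : fieldType) (n m : nat)
    (X : proj_space k n -> Prop) (Y : proj_space k m -> Prop) : Prop :=
  exists (phi : proj_space k n -> proj_space k m)
         (psi : proj_space k m -> proj_space k n),
    [/\ regular_on X phi /\ regular_on Y psi,
        forall P, X P -> Y (phi P),
        forall Q, Y Q -> X (psi Q),
        forall P, X P -> psi (phi P) = P
      & forall Q, Y Q -> phi (psi Q) = Q].

(* The image of the affine curve y^2 = f(x) in P^(g+2) under
   (x, y) |-> [1 : x : ... : x^(g+1) : y]. *)
Definition affine_hyperelliptic (k : fieldType) (g : nat) (f : {poly k}) :
    proj_space k g.+2 -> Prop :=
  fun P => exists x y : k, y ^+ 2 = f.[x] /\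
    hcoords P (\row_(i < g.+3) if (i < g.+2)%N then x ^+ i else y).

(* In characteristic different from 2, for f squarefree of degree 2g+1 or 2g+2,
   this is the non-singular projective model of y^2 = f(x), of genus g: it
   consists of the points
     [s^(g+1) : s^g t : ... : t^(g+1) : y],  y^2 = s^(2g+2) f(t/s),
   and is covered by the smooth affine curves y^2 = f(x) (where s != 0) and
   v^2 = u^(2g+2) f(1/u) (where t != 0), glued along u = 1/x, v = y/x^(g+1).
   The closure of y^2 = f(x) in P^2 would be singular at infinity for
   deg f > 3. *)
Definition hyperelliptic_curve (k : fieldType) (g : nat) (f : {poly k}) :
    proj_space k g.+2 -> Prop :=
  proj_closure (@affine_hyperelliptic k g f).

Definition H_curve (k : fieldType) (lambda : k) : proj_space k 6 -> Prop :=
  @hyperelliptic_curve k 4 ('X * ('X^4 - 1) * ('X^4 - lambda%:P)).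

(* Main.v *)
Require Import Defs.
From HB Require Import structures.
From mathcomp Require Import all_boot all_order all_algebra.
From mathcomp Require Import mpoly ring zify.

Set Implicit Arguments.
Unset Strict Implicit.
Unset Printing Implicit Defensive.

Import GRing.Theory.

Local Open Scope ring_scope.

(** An isomorphism between two curves of this family comes from a Moebius map of
x, because it preserves regular differentials, and ratios of regular
differentials are functions of x. The argument is made elementary as follows.

Let K be the function field of y^2 = f(x), and let D = 2y d/dx, so that D x = 2y
and D y = f'(x). Such a D maps the coordinate ring k[x, y] to itself, hence also
the local ring at every affine point ([has_value_deriv]). Let u, v be the pullbacks
of the two coordinates under the isomorphism, so v^2 = g(u) with g squarefree.
At a point where u and v are regular, so is Du/v: if v vanishes there,
differentiating v^2 = g(u) gives Du/v = 2 Dv/g'(u), and g'(u) does not vanish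
([differential_has_value]). At a pole of u the same applies to 1/u and v/u^5,
which leaves room for three more factors u. So u^j Du/v is regular at every
affine point for j <= 3, hence lies in k[x, y] ([locally_regular_coord]). The
same holds on the chart at infinity, with coordinates 1/x, y/x^5 and derivation
-x^(-3) D; comparing the charts shows that u^j Du/v is a polynomial in x of
degree at most 3 ([two_charts], [differential_poly]).

Write A0, A1, A3 for these polynomials with j = 0, 1, 3. From A0^2 A3 = A1^3 and
the degree bounds, u = A1/A0 is a quotient Q/P of polynomials of degree at most 1
([cube_ratio_linear]). Substituting u and v = Du/A0 in v^2 = g(u) shows that the
binary form of degree ten attached to g, evaluated at (Q, P), is a constant
multiple of f ([moebius_of_maps_into_curve]). All this needs Du <> 0, which
excludes inseparable maps such as Frobenius: the inverse isomorphism expresses x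
rationally in u and v, so D would vanish on x ([isomorphism_separable]).

It remains to compare binary forms ([branch_form_equiv]). The form attached to
x(x^4 - 1)(x^4 - l) contains only the monomials of exponents 1, 5 and 9. A linear
substitution respecting this either preserves the pair 0, infinity, and is then
a scaling up to inversion, which gives l1 = l2 or l1 l2 = 1; or it sends 0 to a
fourth root of 1 or of l2, and then the coefficients of x^2, x^3 and x^4 cannot
all vanish in characteristic different from 2, 3 and 5 ([branch_form_jet_neq0]).

Conversely, a scaling of x by a fourth root of l2 identifies the two curves when
l1 = 1/l2; it is induced by a diagonal map of the ambient projective space
([diag_isomorphic]). *)

(** * Binary forms of degree ten and Moebius maps *)

(** This is x (x^4 - 1) (b x^4 - a). Keeping both a and b makes the family stable
under x -> 1/x, which exchanges them: the chart at infinity is of the same kind. *)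
Definition branch_poly (R : nzRingType) (a b : R) : {poly R} :=
  a *: 'X - (a + b) *: 'X^5 + b *: 'X^9.

(** The homogenization of [branch_poly] in degree 10: the additional linear factor Z
accounts for the branch point at infinity. *)
Definition branch_form (R : comNzRingType) (a b X Z : R) : R :=
  X * Z * (X ^+ 4 - Z ^+ 4) * (b * X ^+ 4 - a * Z ^+ 4).

Section BranchForm.
Variable k : fieldType.
Hypothesis two_neq0 : 2 != 0 :> k.
Hypothesis three_neq0 : 3 != 0 :> k.
Hypothesis five_neq0 : 5 != 0 :> k.

Lemma coef_linear_exp (a b : k) m n :
  ((a *: 'X + b%:P) ^+ m)`_n = (a ^+ n * b ^+ (m - n)) *+ 'C(m, n).
Proof.
rewrite addrC exprDn coef_sum.
have [lenm|ltmn] := leqP n m; last first.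
  rewrite bin_small // mulr0n big1 // => i _.
  rewrite exprZn coefMn -rmorphXn coefCM coefZ coefXn.
  by rewrite gtn_eqF ?mulr0 ?mul0rn // (leq_ltn_trans _ ltmn) // -ltnS.
rewrite (bigD1 (Ordinal (lenm : (n < m.+1)%N))) //= big1 ?addr0 => [|i ne].
  by rewrite exprZn coefMn -rmorphXn coefCM coefZ coefXn eqxx mulr1 mulrC.
rewrite exprZn coefMn -rmorphXn coefCM coefZ coefXn.
by rewrite eq_sym (negPf (ne : val i != n)) !mulr0 mul0rn.
Qed.

Lemma branch_form_sum (R : comNzRingType) (a b X Z : R) :
  branch_form a b X Z =
  a * (X ^+ 1 * Z ^+ 9) - (a + b) * (X ^+ 5 * Z ^+ 5) + b * (X ^+ 9 * Z ^+ 1).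
Proof. rewrite /branch_form; ring. Qed.

Lemma coef_branch_form (a b al be ga et : k) n :
  let S i j := \sum_(l < n.+1) ((al ^+ l * be ^+ (i - l)) *+ 'C(i, l)) *
     ((ga ^+ (n - l) * et ^+ (j - (n - l))) *+ 'C(j, n - l)) in
  (branch_form a%:P b%:P (al *: 'X + be%:P) (ga *: 'X + et%:P))`_n =
  a * S 1%N 9%N - (a + b) * S 5%N 5%N + b * S 9%N 1%N.
Proof.
move=> S; rewrite branch_form_sum -polyCD coefD coefB !coefCM.
rewrite !coefM; do 3?[congr (_ + _)]; try congr (- _);
  congr (_ * _); apply: eq_bigr => i _; by rewrite !coef_linear_exp.
Qed.

(** The form has the factor X - Z, which is here (r - s) x: hence the common factor. *)
Lemma branch_form_jet (a b r s : k) :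
    let F := branch_form a%:P b%:P (r *: 'X + 1%:P) (s *: 'X + 1%:P) in
  [/\ F`_2 = (r - s) * (b * (26 * r + 10 * s) - a * (10 * r + 26 * s)),
      F`_3 = (r - s) * (b * (74 * r ^+ 2 + 60 * r * s + 10 * s ^+ 2)
               - a * (10 * r ^+ 2 + 60 * r * s + 74 * s ^+ 2))
    & F`_4 = (r - s) *
        (b * (121 * r ^+ 3 + 155 * r ^+ 2 * s + 55 * r * s ^+ 2 + 5 * s ^+ 3)
         - a * (5 * r ^+ 3 + 55 * r ^+ 2 * s + 155 * r * s ^+ 2 + 121 * s ^+ 3))].
Proof.
by split; rewrite coef_branch_form !big_ord_recl !big_ord0 /bump /= !expr1n
  !mulr1 /binomial /=; ring.
Qed.

(** The first equation determines a : b as (13r + 5s) : (5r + 13s). The two other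
equations then become 5r^2 + 14rs + 5s^2 = 0 and
(r + s) (45r^2 + 134rs + 45s^2) = 0, that is rs (r + s) = 0, up to factors 2, 3
and r - s. They have no common solution with r != s. *)
Lemma branch_form_jet_neq0 (a b r s : k) :
    a != 0 -> b != 0 -> r != s ->
    let F := branch_form a%:P b%:P (r *: 'X + 1%:P) (s *: 'X + 1%:P) in
  ~ [/\ F`_2 = 0, F`_3 = 0 & F`_4 = 0].
Proof.
move=> a0 b0 rs F; rewrite /F; have [-> -> ->] := branch_form_jet a b r s.
have rs0 : r - s != 0 by rewrite subr_eq0.
case=> /eqP; rewrite mulf_eq0 (negPf rs0) /= => /eqP e2.
have {}e2 : b * (13 * r + 5 * s) - a * (5 * r + 13 * s) = 0.
  by apply: (mulfI two_neq0); rewrite mulr0 -[RHS]e2; ring.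
move/eqP; rewrite mulf_eq0 (negPf rs0) /= => /eqP e3.
move/eqP; rewrite mulf_eq0 (negPf rs0) /= => /eqP e4.
have nz n : a * (2 ^+ n * 3 * (r - s)) != 0 by rewrite !mulf_neq0 ?expf_neq0.
(* The factor 13r + 5s turns b into a multiple of a, by the first equation. *)
have q3 : 5 * r ^+ 2 + 14 * r * s + 5 * s ^+ 2 = 0.
  apply: (mulfI (nz 4)); rewrite mulr0.
  transitivity ((13 * r + 5 * s) *
     (b * (74 * r ^+ 2 + 60 * r * s + 10 * s ^+ 2) -
      a * (10 * r ^+ 2 + 60 * r * s + 74 * s ^+ 2)) -
     (b * (13 * r + 5 * s) - a * (5 * r + 13 * s)) *
     (74 * r ^+ 2 + 60 * r * s + 10 * s ^+ 2)); first by ring.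
  by rewrite e2 e3; ring.
have q4 : r * s * (r + s) = 0.
  apply: (mulfI (nz 5)); rewrite mulr0.
  transitivity ((13 * r + 5 * s) *
     (b * (121 * r ^+ 3 + 155 * r ^+ 2 * s + 55 * r * s ^+ 2 + 5 * s ^+ 3)
       - a * (5 * r ^+ 3 + 55 * r ^+ 2 * s + 155 * r * s ^+ 2 + 121 * s ^+ 3)) -
     (b * (13 * r + 5 * s) - a * (5 * r + 13 * s)) *
     (121 * r ^+ 3 + 155 * r ^+ 2 * s + 55 * r * s ^+ 2 + 5 * s ^+ 3) -
     a * (12 * 9 * (r - s) * (r + s)) * (5 * r ^+ 2 + 14 * r * s + 5 * s ^+ 2)).
    by ring.
  by rewrite e2 e4 q3; ring.
have sq0 (z : k) : 5 * z ^+ 2 = 0 -> z = 0.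
  by move/eqP; rewrite mulf_eq0 (negPf five_neq0) sqrf_eq0 => /eqP.
move/eqP: q4; rewrite !mulf_eq0 -orbA => /or3P[]/eqP.
- move=> r0; case/eqP: rs; move: q3; rewrite r0 => q3.
  by rewrite (sq0 s) // -[RHS]q3; ring.
- move=> s0; case/eqP: rs; move: q3; rewrite s0 => q3.
  by rewrite (sq0 r) // -[RHS]q3; ring.
move/eqP; rewrite addr_eq0 => /eqP r_s; case/eqP: rs; rewrite r_s.
have s2 : 2 ^+ 2 * s ^+ 2 = 0 by rewrite -[RHS]oppr0 -q3 r_s; ring.
move/eqP: s2; rewrite mulf_eq0 !sqrf_eq0 (negPf two_neq0) => /eqP ->.
by rewrite oppr0.
Qed.

Lemma coef_branch_poly (a b : k) n :
  (branch_poly a b)`_n = a *+ (n == 1) - (a + b) *+ (n == 5) + b *+ (n == 9).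
Proof. by rewrite /branch_poly coefD coefB !coefZ coefX !coefXn !mulr_natr. Qed.

(** When 0 goes to 0 or to infinity, the vanishing of the coefficient of x^2 forces the
substitution to be diagonal or antidiagonal; otherwise [branch_form_jet_neq0] gives a
contradiction. *)
Lemma branch_form_equiv (l1 l2 al be ga et c : k) :
    l2 != 0 -> al * et != be * ga -> c != 0 ->
    branch_form l2%:P 1 (al *: 'X + be%:P) (ga *: 'X + et%:P) =
      c *: branch_poly l1 1 ->
  l1 = l2 \/ l1 = 1 / l2.
Proof.
move=> l2n0 det c0 eqF.
(* 9 is the coefficient of x z^8 in the expansion of (x + z)^9. *)
have nine0 : 9 != 0 :> k.
  by rewrite (_ : 9 = 3 * 3) ?mulf_neq0 //; ring.
pose F := branch_form l2%:P 1 (al *: 'X + be%:P) (ga *: 'X + et%:P).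
have coefF n : F`_n = c * (l1 *+ (n == 1) - (l1 + 1) *+ (n == 5) + 1 *+ (n == 9)).
  by rewrite /F eqF coefZ coef_branch_poly.
have coefF0 n : n \notin [:: 1; 5; 9]%N -> F`_n = 0.
  rewrite coefF !inE !negb_or => /and3P[/negPf-> /negPf-> /negPf->].
  by rewrite !mulr0n subr0 addr0 mulr0.
have F0 : F`_0 = 0 by apply: coefF0.
have F2 : F`_2 = 0 by apply: coefF0.
have inv_l2 : l1 * l2 = 1 -> l1 = l2 \/ l1 = 1 / l2.
  by move=> e; right; rewrite -e mulfK.
have coefS (w x y z : k) n :
    F = w *: (x *: 'X - y *: 'X^5 + z *: 'X^9) ->
    F`_n = w * (x *+ (n == 1) - y *+ (n == 5) + z *+ (n == 9)).
  by move->; rewrite coefZ coefD coefB !coefZ coefX !coefXn !mulr_natr.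
(* If 0 goes to 0 or to infinity, so does infinity, and the two curves differ
   by a scaling of x, up to inverting x. *)
have [be0|beN0] := eqVneq be 0.
  have /andP[alN0 etN0] : (al != 0) && (et != 0).
    by move: det; rewrite be0 mul0r mulf_eq0 negb_or.
  have ga0 : ga = 0.
    move: F2; rewrite /F coef_branch_form !big_ord_recl !big_ord0 /bump /= be0
      /binomial /= => e.
    apply: (mulfI (_ : 9 * al * l2 * et ^+ 8 != 0)).
      by rewrite !mulf_neq0 ?expf_neq0.
    by rewrite mulr0 -[RHS]e; ring.
  have eF : F = (al * et) *: ((l2 * et ^+ 8) *: 'X
        - ((l2 + 1) * (al ^+ 4 * et ^+ 4)) *: 'X^5 + al ^+ 8 *: 'X^9).
    rewrite /F be0 ga0 branch_form_sum -!mul_polyC !(rmorphD, rmorphM, rmorphXn).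
    by rewrite polyC0; ring.
  have := coefS _ _ _ _ 1 eF; have := coefS _ _ _ _ 5 eF.
  have := coefS _ _ _ _ 9 eF; rewrite !coefF /=.
  rewrite !(mulr1n, mulr0n, subr0, add0r, addr0, sub0r, mulr1) => e9 e5 e1.
  have w0 : al * et != 0 by rewrite mulf_neq0.
  have l1E : al ^+ 8 * l1 = l2 * et ^+ 8.
    by apply: (mulfI w0); rewrite -e1 e9 mulrA.
  have : (al ^+ 4 - et ^+ 4) * (al ^+ 4 - l2 * et ^+ 4) = 0.
    apply: (mulfI w0); rewrite mulr0.
    transitivity (al * et * al ^+ 8 + al * et * (l2 * et ^+ 8)
                    + al * et * - ((l2 + 1) * (al ^+ 4 * et ^+ 4))); first by ring.
    by rewrite -e5 -e1 -e9; ring.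
  move/eqP; rewrite mulf_eq0 !subr_eq0 => /orP[]/eqP e4.
    left; apply: (mulfI (_ : al ^+ 8 != 0)); first by rewrite expf_neq0.
    by rewrite l1E -[8%N]/(4 * 2)%N !exprM e4 mulrC.
  apply: inv_l2; apply: (mulfI (_ : al ^+ 8 != 0)); first by rewrite expf_neq0.
  by rewrite mulrA l1E -[8%N]/(4 * 2)%N !exprM e4; ring.
have [et0|etN0] := eqVneq et 0.
  have /andP[_ gaN0] : (be != 0) && (ga != 0).
    by move: det; rewrite et0 mulr0 eq_sym mulf_eq0 negb_or.
  have al0 : al = 0.
    move: F2; rewrite /F coef_branch_form !big_ord_recl !big_ord0 /bump /= et0
      /binomial /= => e.
    apply: (mulfI (_ : 9 * be ^+ 8 * ga != 0)).
      by rewrite !mulf_neq0 ?expf_neq0.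
    by rewrite mulr0 -[RHS]e; ring.
  have eF : F = (be * ga) *: (be ^+ 8 *: 'X
        - ((l2 + 1) * (be ^+ 4 * ga ^+ 4)) *: 'X^5 + (l2 * ga ^+ 8) *: 'X^9).
    rewrite /F et0 al0 branch_form_sum -!mul_polyC !(rmorphD, rmorphM, rmorphXn).
    by rewrite polyC0; ring.
  have := coefS _ _ _ _ 1 eF; have := coefS _ _ _ _ 5 eF.
  have := coefS _ _ _ _ 9 eF; rewrite !coefF /=.
  rewrite !(mulr1n, mulr0n, subr0, add0r, addr0, sub0r, mulr1) => e9 e5 e1.
  have w0 : be * ga != 0 by rewrite mulf_neq0.
  have l1E : ga ^+ 8 * (l1 * l2) = be ^+ 8.
    apply: (mulfI w0); rewrite -e1 e9; ring.
  have : (be ^+ 4 - ga ^+ 4) * (be ^+ 4 - l2 * ga ^+ 4) = 0.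
    apply: (mulfI w0); rewrite mulr0.
    transitivity (be * ga * be ^+ 8 + be * ga * (l2 * ga ^+ 8)
                    + be * ga * - ((l2 + 1) * (be ^+ 4 * ga ^+ 4))); first by ring.
    by rewrite -e5 -e1 -e9; ring.
  move/eqP; rewrite mulf_eq0 !subr_eq0 => /orP[]/eqP e4.
    apply: inv_l2; apply: (mulfI (_ : ga ^+ 8 != 0)); first by rewrite expf_neq0.
    by rewrite l1E -[8%N]/(4 * 2)%N !exprM e4 mulr1.
  left; apply: (mulfI l2n0); apply: (mulfI (_ : ga ^+ 8 != 0)).
    by rewrite expf_neq0.
  by rewrite (mulrC l2 l1) l1E -[8%N]/(4 * 2)%N !exprM e4; ring.
(* Otherwise 0 goes to a fourth root of 1 or l2. Dividing the two homogeneous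
   coordinates by be and et moves this root to 1, and in the second case
   exchanges the two coefficients of the form. *)
exfalso; pose r := al / be; pose s := ga / et.
have rs : r != s.
  by apply: contraNneq det => e; rewrite -(divfK beN0 al) -/r e /s; apply/eqP; field.
have jet (a b w : k) : a != 0 -> b != 0 -> w != 0 ->
    F = w *: branch_form a%:P b%:P (r *: 'X + 1%:P) (s *: 'X + 1%:P) -> False.
  move=> a0 b0 w0 eF; apply: (branch_form_jet_neq0 a0 b0 rs).
  have coef0 n : n \notin [:: 1; 5; 9]%N ->
      (branch_form a%:P b%:P (r *: 'X + 1%:P) (s *: 'X + 1%:P))`_n = 0.
    by move=> /coefF0; rewrite eF coefZ => /eqP; rewrite mulf_eq0 (negPf w0) => /eqP.
  by split; apply: coef0.
have : (be ^+ 4 - et ^+ 4) * (be ^+ 4 - l2 * et ^+ 4) = 0.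
  apply: (mulfI (mulf_neq0 beN0 etN0)); rewrite mulr0 -[RHS]F0 /F.
  rewrite coef_branch_form !big_ord_recl !big_ord0 /bump /= /binomial /=; ring.
have lin : al *: 'X + be%:P = be%:P * (r *: 'X + 1%:P)
         /\ ga *: 'X + et%:P = et%:P * (s *: 'X + 1%:P).
  by split; rewrite mulrDr mulr1 mul_polyC scalerA mulrC divfK.
move/eqP; rewrite mulf_eq0 !subr_eq0 => /orP[]/eqP e4.
  apply: (jet l2 1 (be * et ^+ 9)); rewrite ?oner_neq0 ?mulf_neq0 ?expf_neq0 //.
  rewrite /F; case: lin => -> ->; rewrite -!mul_polyC !(rmorphD, rmorphM, rmorphXn).
  rewrite /branch_form !exprMn -!rmorphXn /= e4 !rmorphXn; ring.
apply: (jet 1 l2 (l2 * be * et ^+ 9)); rewrite ?oner_neq0 ?mulf_neq0 ?expf_neq0 //.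
rewrite /F; case: lin => -> ->; rewrite -!mul_polyC !(rmorphD, rmorphM, rmorphXn).
rewrite /branch_form !exprMn -!rmorphXn /= e4 !(rmorphM, rmorphXn); ring.
Qed.

End BranchForm.

(** * The coordinate ring of an affine hyperelliptic curve *)

Record odd_degree_poly (k : fieldType) :=
  OddDegreePoly { odd_poly_val :> {poly k}; odd_polyP : odd (size odd_poly_val).-1 }.

(** The ring k[x, y] / (y^2 - f(x)), with (A, B) standing for A(x) + B(x) y. The
polynomial f is bundled with the parity of its degree, which makes this ring an
integral domain. *)
Definition coord_ring (k : fieldType) (f : odd_degree_poly k) : Type :=
  ({poly k} * {poly k})%type.

Section CoordRing.
Variables (k : fieldType) (f : odd_degree_poly k).
Local Notation R := (coord_ring f).

HB.instance Definition _ := GRing.Zmodule.on R.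

Definition coord_one : R := (1, 0).
Definition coord_mul (p q : R) : R :=
  (p.1 * q.1 + p.2 * q.2 * f, p.1 * q.2 + p.2 * q.1).

Fact coord_mulA : associative coord_mul.
Proof. by move=> p q r; congr pair => /=; ring. Qed.
Fact coord_mulC : commutative coord_mul.
Proof. by move=> p q; congr pair => /=; ring. Qed.
Fact coord_mul1 : left_id coord_one coord_mul.
Proof. by case=> p q; congr pair => /=; ring. Qed.
Fact coord_mulD : left_distributive coord_mul +%R.
Proof. by move=> p q r; congr pair => /=; ring. Qed.
Fact coord_one_neq0 : coord_one != 0.
Proof. by apply/eqP=> -[] /eqP; rewrite oner_eq0. Qed.

HB.instance Definition _ := GRing.Zmodule_isComNzRing.Build R
  coord_mulA coord_mulC coord_mul1 coord_mulD coord_one_neq0.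

Definition coord_norm (p : R) : {poly k} := p.1 ^+ 2 - p.2 ^+ 2 * f.

Lemma coord_normM p q : coord_norm (p * q) = coord_norm p * coord_norm q.
Proof. by rewrite /coord_norm /=; ring. Qed.

(** A^2 has even degree and B^2 f odd degree, so they cannot cancel. *)
Lemma coord_norm_eq0 p : (coord_norm p == 0) = (p == 0).
Proof.
apply/eqP/eqP => [|->]; last by rewrite /coord_norm expr0n mul0r subr0.
have odd_f := odd_polyP f.
have f0 : f != 0 :> {poly k} by apply: contraTneq odd_f => ->; rewrite size_poly0.
case: p => A B; rewrite /coord_norm /= => /eqP; rewrite subr_eq0 => /eqP e.
have [B0|BN0] := eqVneq B 0.
  by move: e; rewrite B0 expr0n mul0r => /eqP; rewrite sqrf_eq0 => /eqP->.
have AN0 : A != 0.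
  by rewrite -sqrf_eq0 e mulf_neq0 // expf_neq0.
have := congr1 (fun q : {poly k} => odd (size q).-1) e.
rewrite !expr2 !size_mul ?mulf_neq0 //.
have: (0 < size f)%N by rewrite size_poly_gt0.
have: (0 < size A)%N by rewrite size_poly_gt0.
have: (0 < size B)%N by rewrite size_poly_gt0.
case: (size A) (size B) (size f) odd_f => // a [] // b [] // c /= oc _ _ _.
by rewrite !addnS /= !oddD !addbb oc.
Qed.

Definition coord_conj (p : R) : R := (p.1, - p.2).

Lemma coord_mul_conj p : p * coord_conj p = (coord_norm p, 0) :> R.
Proof. by congr pair; rewrite /coord_norm /=; ring. Qed.

Definition coord_unit : {pred R} := [pred p | coord_norm p \is a GRing.unit].
Definition coord_inv (p : R) : R :=
  if coord_unit p then coord_conj p * ((coord_norm p)^-1, 0) else p.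

Fact coord_mulVr : {in coord_unit, left_inverse 1 coord_inv *%R}.
Proof.
move=> p pU; rewrite /coord_inv [coord_unit p]pU mulrC mulrA coord_mul_conj.
by congr pair => /=; rewrite !(mul0r, mulr0, addr0) ?divrr.
Qed.
Fact coord_unitP p q : q * p = 1 -> coord_unit p.
Proof.
move=> qp; apply/unitrPr; exists (coord_norm q).
by rewrite mulrC -coord_normM qp /coord_norm /= expr0n mul0r subr0 expr1n.
Qed.
Fact coord_inv_out : {in [predC coord_unit], coord_inv =1 id}.
Proof. by move=> p /negPf pU; rewrite /coord_inv [coord_unit p]pU. Qed.

HB.instance Definition _ := GRing.ComNzRing_hasMulInverse.Build R
  coord_mulVr coord_unitP coord_inv_out.

Fact coord_integral (p q : R) : p * q = 0 -> (p == 0) || (q == 0).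
Proof.
by move/eqP; rewrite -(coord_norm_eq0 (p * q)) coord_normM mulf_eq0 !coord_norm_eq0.
Qed.

HB.instance Definition _ := GRing.ComUnitRing_isIntegral.Build R coord_integral.

Definition coord_const (c : k) : R := (c%:P, 0).

Fact coord_const_zmod : zmod_morphism (coord_const : k -> R).
Proof. by move=> a b; congr pair; rewrite ?rmorphB ?subr0. Qed.
Fact coord_const_monoid : monoid_morphism (coord_const : k -> R).
Proof.
by split=> // a b; congr pair; rewrite /= ?mulr0 ?mul0r ?addr0 ?rmorphM.
Qed.
HB.instance Definition _ :=
  GRing.isZmodMorphism.Build k R coord_const coord_const_zmod.
HB.instance Definition _ :=
  GRing.isMonoidMorphism.Build k R coord_const coord_const_monoid.

Definition coord_x : R := ('X, 0).
Definition coord_y : R := (0, 1).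

(** The derivation 2y d/dx: the factor 2y clears the denominator of dy/dx, so that
the coordinate ring is preserved. *)
Definition coord_deriv (p : R) : R :=
  (p.2^`() * f *+ 2 + p.2 * f^`(), p.1^`() *+ 2).

End CoordRing.

Arguments coord_const {k} f.
Arguments coord_x {k} f.
Arguments coord_y {k} f.

Section CoordEval.
Variables (k : fieldType) (f : odd_degree_poly k).
Variables (L : comNzRingType) (iota : {rmorphism k -> L}) (x y : L).
Local Notation "A ^i" := (map_poly iota A) (at level 2, format "A ^i").
Local Notation R := (coord_ring f).

(** Evaluation serves two purposes: with values in k it is the evaluation at a point
of the curve, with values in a function field it is the embedding given by a
chart. The equation is an argument in order that the map be canonically a ring
morphism. *)
Definition coord_eval of y ^+ 2 = (f^i).[x] := fun p : R =>
  (p.1^i).[x] + (p.2^i).[x] * y.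

Hypothesis yE : y ^+ 2 = (f^i).[x].
Local Notation ev := (coord_eval yE).

Fact coord_eval_zmod : zmod_morphism (ev : R -> L).
Proof.
by move=> p q; rewrite /coord_eval /= !rmorphB !hornerD !hornerN; ring.
Qed.
Fact coord_eval_monoid : monoid_morphism (ev : R -> L).
Proof.
split=> [|p q]; rewrite /coord_eval /= ?rmorph1 ?rmorph0 ?hornerC ?mul0r ?addr0 //.
rewrite !(rmorphD, rmorphM) !(hornerD, hornerM) -yE; ring.
Qed.
HB.instance Definition _ :=
  GRing.isZmodMorphism.Build R L ev coord_eval_zmod.
HB.instance Definition _ :=
  GRing.isMonoidMorphism.Build R L ev coord_eval_monoid.

Lemma coord_eval_const c : ev (coord_const f c) = iota c.
Proof. by rewrite /coord_eval /= map_polyC rmorph0 !hornerC mul0r addr0. Qed.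
Lemma coord_eval_x : ev (coord_x f) = x.
Proof. by rewrite /coord_eval /= map_polyX hornerX rmorph0 hornerC mul0r addr0. Qed.
Lemma coord_eval_y : ev (coord_y f) = y.
Proof. by rewrite /coord_eval /= rmorph1 rmorph0 !hornerC mul1r add0r. Qed.

Lemma coord_eval_norm p :
  ev p * ev (coord_conj p) = ((coord_norm p)^i).[x].
Proof.
by rewrite -rmorphM /= coord_mul_conj /coord_eval /= rmorph0 hornerC mul0r addr0.
Qed.

End CoordEval.

(** * Derivations, and local rings at the points of the curve *)

Section Derivation.
Variables (k : fieldType) (L : fieldType) (iota : {rmorphism k -> L}).
Local Notation "A ^i" := (map_poly iota A) (at level 2, format "A ^i").

Definition derivation_over (D : L -> L) : Prop :=
  [/\ {morph D : a b / a + b}, forall a b, D (a * b) = D a * b + a * D b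
    & forall c, D (iota c) = 0].

Variable D : L -> L.
Hypothesis D_der : derivation_over D.

Lemma derD a b : D (a + b) = D a + D b. Proof. by case: D_der => ->. Qed.
Lemma derM a b : D (a * b) = D a * b + a * D b.
Proof. by case: D_der => _ ->. Qed.
Lemma derC c : D (iota c) = 0. Proof. by case: D_der => _ _ ->. Qed.
Lemma der0 : D 0 = 0. Proof. by have := derC 0; rewrite rmorph0. Qed.
Lemma der1 : D 1 = 0. Proof. by rewrite -(rmorph1 iota) derC. Qed.

Lemma derV a : a != 0 -> D a^-1 = - D a / a ^+ 2.
Proof.
move=> a0; have := derM a a^-1; rewrite mulfV // der1 => e.
apply: (mulfI a0); rewrite -[LHS](addKr (D a / a)) -e; field.
by [].
Qed.

Lemma der_div a b : b != 0 -> D (a / b) = (D a * b - a * D b) / b ^+ 2.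
Proof. by move=> b0; rewrite derM derV //; field. Qed.

Lemma derX a n : D (a ^+ n.+1) = D a * a ^+ n *+ n.+1.
Proof.
elim: n => [|n IHn]; first by rewrite expr0 mulr1.
by rewrite exprS derM IHn [in RHS]mulrS mulrnAr mulrCA -exprS.
Qed.

Lemma der_poly A z : D (A^i).[z] = (A^`()^i).[z] * D z.
Proof.
elim/poly_ind: A => [|A c IHA].
  by rewrite deriv0 !map_poly0 !horner0 der0 mul0r.
rewrite derivMXaddC !(rmorphD, rmorphM) /= map_polyX map_polyC /=.
rewrite !(hornerD, hornerM, hornerX, hornerC) derD derC derM IHA; ring.
Qed.

Lemma der_mmap_eq0 n (v : 'I_n -> L) (F : {mpoly k[n]}) :
  (forall i, D (v i) = 0) -> D (mmap iota v F) = 0.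
Proof.
move=> Dv; have DX m : D (mmap1 v m) = 0.
  rewrite /mmap1; elim/big_ind: _ => [|a b a0 b0|i _]; first exact: der1.
    by rewrite derM a0 b0 mul0r mulr0 addr0.
  by case: (m i) => [|j]; rewrite ?der1 // derX Dv mul0r mul0rn.
rewrite /mmap; elim/big_ind: _ => [|a b a0 b0|m _]; first exact: der0.
  by rewrite derD a0 b0 addr0.
by rewrite derM derC DX mul0r mulr0 addr0.
Qed.

End Derivation.

Lemma closed_field_root (k : closedFieldType) n (a : k) :
  (0 < n)%N -> exists r : k, r ^+ n = a.
Proof.
move=> n0.
have [r rE] := @GRing.solve_monicpoly k n (fun i => if i == 0%N then a else 0) n0.
case: n n0 rE => // n _; rewrite big_ord_recl big1 /= => [|i _]; last by rewrite mul0r.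
by rewrite mulr1 addr0 => <-; exists r.
Qed.

Section Points.
Variables (k : closedFieldType) (f : odd_degree_poly k).

Lemma point_exists c : exists e : k, e ^+ 2 = (map_poly idfun f).[c].
Proof. exact: closed_field_root. Qed.

(** The norm vanishes at every c in k, because each c is the abscissa of a point. *)
Lemma coord_vanish (p : coord_ring f) :
    (forall c e (pE : e ^+ 2 = (map_poly idfun f).[c]), coord_eval pE p = 0) ->
  p = 0.
Proof.
move=> p0; apply/eqP; rewrite -coord_norm_eq0; apply/negPn/negP.
move=> /closed_nonrootP[c]; have [e pE] := point_exists c.
have := coord_eval_norm pE p.
by rewrite p0 mul0r map_poly_id // /root => <-; rewrite eqxx.
Qed.

End Points.

Section LocalRings.
Variables (k : closedFieldType) (f : odd_degree_poly k).
Variables (L : fieldType) (iota : {rmorphism k -> L}) (x y : L).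
Local Notation "A ^i" := (map_poly iota A) (at level 2, format "A ^i").
Local Notation R := (coord_ring f).
Hypothesis yE : y ^+ 2 = (f^i).[x].
Hypothesis x_transc : forall c, x != iota c.
Local Notation ev := (coord_eval yE).

(** Over an algebraically closed field, an element outside k is transcendental: a
nonzero polynomial is a product of factors X - c. *)
Lemma horner_transc_eq0 (A : {poly k}) : (A^i).[x] = 0 -> A = 0.
Proof.
move=> A0; apply/eqP; apply: contraT => AN0.
have [r eA] := closed_field_poly_normal A.
move/eqP: A0; rewrite eA map_polyZ hornerZ mulf_eq0 fmorph_eq0 lead_coef_eq0.
rewrite (negPf AN0) /= rmorph_prod horner_prod prodf_seq_eq0 => /hasP[c _ /=].
rewrite rmorphB /= map_polyX map_polyC hornerD hornerN hornerX hornerC subr_eq0.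
by rewrite (negPf (x_transc c)).
Qed.

Lemma coord_eval_eq0 (p : R) : ev p = 0 -> p = 0.
Proof.
move=> p0; apply/eqP; rewrite -coord_norm_eq0; apply/eqP/horner_transc_eq0.
by rewrite -(coord_eval_norm yE) p0 mul0r.
Qed.

Lemma coord_eval_inj : injective ev.
Proof.
move=> p q /eqP; rewrite -subr_eq0 -rmorphB => /eqP/coord_eval_eq0/eqP.
by rewrite subr_eq0 => /eqP.
Qed.

Section At.
Variables (c e : k) (pE : e ^+ 2 = (map_poly idfun f).[c]).
Local Notation evp := (coord_eval pE).

(** This says that z belongs to the local ring at the point (c, e) and has residue a
there. *)
Definition has_value (z : L) (a : k) : Prop :=
  exists s r : R, [/\ evp s != 0, ev s * z = ev r & evp r = a * evp s].

Lemma has_value_coord p : has_value (ev p) (evp p).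
Proof. by exists 1, p; rewrite !rmorph1 mul1r mulr1 oner_eq0. Qed.

Lemma has_value_const a : has_value (iota a) a.
Proof.
by have := has_value_coord (coord_const f a); rewrite !coord_eval_const.
Qed.

Lemma has_valueD z z' a a' :
  has_value z a -> has_value z' a' -> has_value (z + z') (a + a').
Proof.
move=> [s [r [s0 e1 e2]]] [s' [r' [s'0 e1' e2']]].
exists (s * s'), (r * s' + s * r').
rewrite !rmorphD !rmorphM /= -e1 -e1' e2 e2' mulf_neq0 //; split=> //; ring.
Qed.

Lemma has_valueM z z' a a' :
  has_value z a -> has_value z' a' -> has_value (z * z') (a * a').
Proof.
move=> [s [r [s0 e1 e2]]] [s' [r' [s'0 e1' e2']]].
exists (s * s'), (r * r').
rewrite !rmorphM /= -e1 -e1' e2 e2' mulf_neq0 //; split=> //; ring.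
Qed.

Lemma has_valueX z a n : has_value z a -> has_value (z ^+ n) (a ^+ n).
Proof.
move=> za; elim: n => [|n IHn]; last by rewrite !exprS; apply: has_valueM.
by rewrite !expr0 -(rmorph1 iota); apply: has_value_const.
Qed.

Lemma has_value_poly A z a : has_value z a -> has_value (A^i).[z] A.[a].
Proof.
move=> za; elim/poly_ind: A => [|A b IHA].
  by rewrite rmorph0 !horner0 -(rmorph0 iota); apply: has_value_const.
rewrite rmorphD rmorphM /= map_polyX map_polyC !(hornerD, hornerM, hornerX, hornerC).
by apply: has_valueD; [apply: has_valueM | apply: has_value_const].
Qed.

Lemma has_value_inj z a a' : has_value z a -> has_value z a' -> a = a'.
Proof.
move=> [s [r [s0 e1 e2]]] [s' [r' [s'0 e1' e2']]].
have /coord_eval_inj eq_sr : ev (s' * r) = ev (s * r').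
  by rewrite !rmorphM /= -e1 -e1'; ring.
have := congr1 evp eq_sr; rewrite !rmorphM /= e2 e2' => eq_a.
apply: (mulIf (mulf_neq0 s0 s'0)).
by transitivity (evp s' * (a * evp s)); [ring | rewrite eq_a; ring].
Qed.

Lemma has_valueV z a : a != 0 -> has_value z a -> has_value z^-1 a^-1.
Proof.
move=> a0 [s [r [s0 e1 e2]]].
have r0 : evp r != 0 by rewrite e2 mulf_neq0.
have z0 : z != 0.
  apply: contraNneq r0 => z0; move/esym: e1; rewrite z0 mulr0 => /coord_eval_eq0->.
  by rewrite rmorph0.
exists r, s; split=> //; first by rewrite -e1 mulfK.
by rewrite e2 mulKf.
Qed.

Variable D : L -> L.
Hypothesis D_der : derivation_over iota D.
Hypotheses (Dx : D x = y *+ 2) (Dy : D y = (f^`()^i).[x]).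

Lemma deriv_coord_eval p : D (ev p) = ev (coord_deriv p).
Proof.
rewrite /coord_eval (derD D_der) (derM D_der) !(der_poly D_der) Dx Dy /=.
rewrite !(rmorphD, rmorphM, rmorphMn) /= !(hornerD, hornerM, hornerMn) -yE; ring.
Qed.

Lemma has_value_deriv z a : has_value z a -> exists b, has_value (D z) b.
Proof.
move=> [s [r [s0 e1 e2]]].
pose t := s * coord_deriv r - coord_deriv s * r.
exists (evp t / evp s ^+ 2), (s ^+ 2), t; split.
- by rewrite rmorphXn expf_neq0.
- have := congr1 D e1; rewrite (derM D_der) !deriv_coord_eval => eD.
  by rewrite /t rmorphB !rmorphM /= -eD -e1; ring.
- by rewrite rmorphXn /= divfK // expf_neq0.
Qed.

End At.

Hypothesis two_neq0 : 2 != 0 :> k.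

(** If s z is in the ring with s invertible at the point, then s n = C s z shows that
n vanishes at every point above c. Two such points with distinct ordinates
determine both components of n; at a branch point e = 0, the second component
is read off from the product s n itself. *)
Lemma locally_regular_divides z (C : {poly k}) (n : R) c :
    (forall c e (pE : e ^+ 2 = (map_poly idfun f).[c]), exists a, has_value pE z a) ->
    (C^i).[x] * z = ev n -> C.[c] = 0 ->
  n.1.[c] = 0 /\ n.2.[c] = 0.
Proof.
move=> reg Cz C0.
have val_n e (pE : e ^+ 2 = (map_poly idfun f).[c]) : exists s r : R,
    [/\ coord_eval pE s != 0, s * n = ((C, 0) : R) * r & coord_eval pE n = 0].
  have [_ [s [r [s0 e1 _]]]] := reg _ _ pE; exists s, r.
  have sn : s * n = ((C, 0) : R) * r.
    apply: coord_eval_inj; rewrite !rmorphM /= -Cz -e1 [coord_eval yE (C, 0)]/coord_eval.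
    by rewrite /= rmorph0 hornerC; ring.
  split=> //; apply: (mulfI s0); rewrite mulr0 -rmorphM sn rmorphM /=.
  by rewrite [coord_eval pE (C, 0)]/coord_eval /= !map_poly_id // C0 hornerC !mul0r addr0 mul0r.
have [e pE] := point_exists f c.
have [s [r [s0 sn nE]]] := val_n _ pE.
have mE : (- e) ^+ 2 = (map_poly idfun f).[c] by rewrite sqrrN.
have [_ [_ [_ _ nE']]] := val_n _ mE.
move: nE nE'; rewrite /coord_eval !map_poly_id // mulrN => nE nE'.
have n1 : n.1.[c] = 0.
  by apply: (mulfI two_neq0); rewrite mulr0 -[RHS]addr0 -{1}nE -nE'; ring.
split=> //; have [e0|e0] := eqVneq e 0; last first.
  by apply: (mulIf e0); rewrite mul0r -[RHS]nE n1 add0r.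
move: s0; rewrite /coord_eval !map_poly_id // e0 mulr0 addr0 => s0.
apply: (mulfI s0); rewrite mulr0.
have := congr1 (fun p : R => p.2.[c]) sn.
by rewrite /= mul0r addr0 !(hornerD, hornerM) n1 C0 mulr0 addr0 mul0r.
Qed.

(** A nonzero multiple C(x) z lies in the ring, thanks to norms, and the factors X - c
of C can be cancelled one at a time. *)
Lemma locally_regular_coord z :
    (forall c e (pE : e ^+ 2 = (map_poly idfun f).[c]), exists a, has_value pE z a) ->
  exists p : R, z = ev p.
Proof.
move=> reg.
have [C [n [CN0 Cz]]] : exists C n, C != 0 /\ (C^i).[x] * z = ev n.
  have [e pE] := point_exists f 0.
  have [_ [s [r [s0 e1 _]]]] := reg _ _ pE.
  exists (coord_norm s), (r * coord_conj s); split.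
    by rewrite coord_norm_eq0; apply: contraNneq s0 => ->; rewrite rmorph0.
  by rewrite -(coord_eval_norm yE) rmorphM /= -e1; ring.
have [m sizeC] := ubnP (size C); elim: m C n sizeC CN0 Cz => // m IHm C n sizeC CN0 Cz.
have [C1|C1] := eqVneq (size C) 1%N.
  have [|c cN0 eC] := size_poly1P C _; first by rewrite C1.
  exists (coord_const f c^-1 * n).
  rewrite rmorphM /= coord_eval_const -Cz eC map_polyC hornerC /= fmorphV mulKf //.
  by rewrite fmorph_eq0.
have /closed_rootP[c rc] := C1; have C0 := eqP rc.
have [n10 n20] := locally_regular_divides reg Cz C0.
have /factor_theorem[C' eC] := rc.
have /factor_theorem[n1 en1] : root n.1 c by apply/eqP.
have /factor_theorem[n2 en2] : root n.2 c by apply/eqP.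
have xc : x - iota c != 0 by rewrite subr_eq0.
have eval_factor (A : {poly k}) : ((A * ('X - c%:P))^i).[x] = (A^i).[x] * (x - iota c).
  by rewrite rmorphM rmorphB /= map_polyX map_polyC hornerM hornerD hornerN hornerX hornerC.
have C'N0 : C' != 0 by apply: contraNneq CN0 => C'0; rewrite eC C'0 mul0r.
apply: (IHm C' (n1, n2) _ C'N0).
  by move: sizeC; rewrite eC size_Mmonic ?monicXsubC // size_XsubC addn2.
apply: (mulIf xc); rewrite mulrAC -eval_factor -eC Cz /coord_eval en1 en2 /=.
by rewrite !eval_factor; ring.
Qed.

End LocalRings.

(** * The function field and its derivation *)

(** The field of fractions is presented by two functions num and den that choose a
representative of each element: the derivative is then given by a formula, and the
point is its independence of the choice. *)
Section QuotientRule.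
Variables (R : comNzRingType) (d : R -> R) (L : fieldType) (phi : {rmorphism R -> L}).
Hypothesis phi_inj : injective phi.
Variables num den : L -> R.
Hypothesis den_neq0 : forall z, phi (den z) != 0.
Hypothesis num_den : forall z, z * phi (den z) = phi (num z).
Hypothesis d_add : {morph d : a b / a + b}.
Hypothesis d_mul : forall a b, d (a * b) = d a * b + a * d b.

Definition quot_deriv (z : L) : L :=
  (phi (d (num z)) * phi (den z) - phi (num z) * phi (d (den z))) / phi (den z) ^+ 2.

(** Independence of the representative: differentiate n m' = n' m. *)
Lemma quot_derivE z n m : phi m != 0 -> z * phi m = phi n ->
  quot_deriv z = (phi (d n) * phi m - phi n * phi (d m)) / phi m ^+ 2.
Proof.
move=> m0 zm; rewrite /quot_deriv.
have := num_den z; have := den_neq0 z.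
move: (num z) (den z) => n' m' m'0 zm'.
have en : n * m' = n' * m by apply: phi_inj; rewrite !rmorphM /= -zm -zm'; ring.
have := congr1 (fun a => phi (d a)) en.
rewrite !d_mul !rmorphD !rmorphM /= -zm -zm' => e.
have -> : phi (d n') = (phi (d n) * phi m' + z * phi m * phi (d m')
    - z * phi m' * phi (d m)) / phi m by rewrite e; field.
by field; rewrite m0 m'0.
Qed.

Lemma quot_deriv_ext a : quot_deriv (phi a) = phi (d a).
Proof.
have d1 : d 1 = 0.
  by apply: (addrI (d 1)); rewrite addr0 -[in RHS](mulr1 1) d_mul mulr1 mul1r.
rewrite (@quot_derivE _ a 1) rmorph1 ?oner_neq0 ?mulr1 //.
by rewrite d1 rmorph0 mulr0 subr0 expr1n divr1.
Qed.

Lemma quot_derivD : {morph quot_deriv : a b / a + b}.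
Proof.
move=> a b; have := num_den a; have := num_den b.
have := den_neq0 a; have := den_neq0 b.
move: (num a) (den a) (num b) (den b) => n m n' m' m'0 m0 eb ea.
rewrite (quot_derivE m0 ea) (quot_derivE m'0 eb).
rewrite (@quot_derivE _ (n * m' + m * n') (m * m')); last first.
- by rewrite rmorphD !rmorphM /= -ea -eb; ring.
- by rewrite rmorphM mulf_neq0.
rewrite !(d_add, d_mul) !(rmorphD, rmorphM) /=; field.
by rewrite m0 m'0.
Qed.

Lemma quot_derivM a b : quot_deriv (a * b) = quot_deriv a * b + a * quot_deriv b.
Proof.
have := num_den a; have := num_den b.
have := den_neq0 a; have := den_neq0 b.
move: (num a) (den a) (num b) (den b) => n m n' m' m'0 m0 eb ea.
rewrite (quot_derivE m0 ea) (quot_derivE m'0 eb).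
rewrite (@quot_derivE _ (n * n') (m * m')); last first.
- by rewrite !rmorphM /= -ea -eb; ring.
- by rewrite rmorphM mulf_neq0.
have -> : a = phi n / phi m by rewrite -ea mulfK.
have -> : b = phi n' / phi m' by rewrite -eb mulfK.
rewrite !d_mul !(rmorphD, rmorphM) /=; field.
by rewrite m0 m'0.
Qed.

End QuotientRule.

Section FunctionField.
Variables (k : fieldType) (f : odd_degree_poly k).
Local Notation R := (coord_ring f).
Local Notation K := {fraction R}.
Local Notation tofrac := (@FracField.tofrac R).

Lemma frac_num_den (R' : idomainType) (z : {fraction R'}) :
  z * FracField.tofrac (\d_(repr z)) = FracField.tofrac (\n_(repr z)).
Proof.
rewrite -{1}[z]reprK; move: (repr z) => r.
unlock FracField.tofrac; rewrite -[LHS]FracField.pi_mul; apply/eqmodP.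
by rewrite /= FracField.equivfE /FracField.mulf !numden_Ratio ?mulf_neq0
  ?oner_neq0 ?denom_ratioP // !mulr1 mulrC.
Qed.

Definition function_field_const (c : k) : K := tofrac (coord_const f c).
HB.instance Definition _ := GRing.RMorphism.copy function_field_const
  (tofrac \o coord_const f).

Lemma coord_derivD : {morph @coord_deriv k f : a b / a + b}.
Proof. by move=> a b; congr pair; rewrite /= derivD; ring. Qed.

Lemma coord_derivM (a b : R) :
  coord_deriv (a * b) = coord_deriv a * b + a * coord_deriv b.
Proof.
by congr pair; rewrite /= !(derivD, derivM); ring.
Qed.

Lemma function_field_horner (A : {poly k}) :
  (map_poly function_field_const A).[tofrac (coord_x f)] = tofrac ((A, 0) : R).
Proof.
elim/poly_ind: A => [|A c IHA]; first by rewrite map_poly0 horner0 rmorph0.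
rewrite rmorphD rmorphM /= map_polyX map_polyC hornerMXaddC IHA.
rewrite -rmorphM -rmorphD; congr (tofrac _); congr pair => /=; ring.
Qed.

(** The field of fractions of the coordinate ring, with the unique extension of
[coord_deriv] to it. *)
Lemma function_field_exists : exists (K : fieldType) (iota : {rmorphism k -> K})
    (x y : K) (D : K -> K),
  [/\ y ^+ 2 = (map_poly iota f).[x], forall c, x != iota c,
      derivation_over iota D, D x = y *+ 2 & D y = (map_poly iota f^`()).[x]].
Proof.
pose num (z : K) := \n_(repr z); pose den (z : K) := \d_(repr z).
have inj : injective tofrac by move=> a b /eqP; rewrite tofrac_eq => /eqP.
have den0 z : tofrac (den z) != 0 by rewrite tofrac_eq0 denom_ratioP.
have nd z : z * tofrac (den z) = tofrac (num z) by apply: frac_num_den.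
have ext := quot_deriv_ext inj den0 nd coord_derivM.
exists K, function_field_const, (tofrac (coord_x f)), (tofrac (coord_y f)).
exists (quot_deriv (@coord_deriv k f) tofrac num den); split.
- rewrite function_field_horner -rmorphXn; congr (tofrac _).
  by rewrite expr2; congr pair => /=; ring.
- move=> c; apply/eqP=> /inj[] /(congr1 (fun A : {poly k} => size A)).
  by rewrite size_polyX size_polyC; case: (c != 0).
- split; first exact: (quot_derivD inj den0 nd coord_derivD coord_derivM).
    exact: (quot_derivM inj den0 nd coord_derivM).
  move=> c; rewrite ext -(rmorph0 tofrac); congr (tofrac _).
  by congr pair; rewrite /= ?derivC ?deriv0 ?mul0rn //; ring.
- rewrite ext -rmorphMn; congr (tofrac _).
  by rewrite mulr2n; congr pair; rewrite /= ?derivX ?deriv0; ring.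
- rewrite ext function_field_horner; congr (tofrac _).
  by congr pair; rewrite /= ?deriv0 ?(derivC 1); ring.
Qed.

End FunctionField.

(** * Regularity of the differentials du/v *)

Section BranchPoly.
Variable k : fieldType.
Hypothesis two_neq0 : 2 != 0 :> k.

Lemma size_branch_poly (a b : k) : b != 0 -> size (branch_poly a b) = 10.
Proof.
move=> b0; rewrite /branch_poly addrC size_polyDl size_scale ?size_polyXn //.
rewrite (leq_ltn_trans (size_polyD _ _)) // size_polyN ltnS geq_max.
by rewrite !(leq_trans (size_scale_leq _ _)) ?size_polyX ?size_polyXn.
Qed.

Lemma horner_branch_poly (R : comNzRingType) (a b c : R) :
  (branch_poly a b).[c] = a * c - (a + b) * c ^+ 5 + b * c ^+ 9.
Proof. by rewrite /branch_poly !hornerE. Qed.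

Lemma map_branch_poly (L : nzRingType) (iota : {rmorphism k -> L}) (a b : k) :
  map_poly iota (branch_poly a b) = branch_poly (iota a) (iota b).
Proof.
by rewrite /branch_poly rmorphD rmorphB /= !map_polyZ /= !map_polyXn map_polyX rmorphD.
Qed.

Lemma horner_deriv_branch_poly (R : comNzRingType) (a b c : R) :
  (branch_poly a b)^`().[c] = a - (a + b) * 5 * c ^+ 4 + b * 9 * c ^+ 8.
Proof.
by rewrite /branch_poly derivD derivB !derivZ derivX !derivXn !hornerE /=; ring.
Qed.

(** At a root of c, of c^4 - 1 or of b c^4 - a the derivative equals a, 4 (b - a) or
4a (a - b) / b respectively. *)
Lemma branch_poly_separable (a b c : k) :
    a != 0 -> b != 0 -> a != b -> (branch_poly a b).[c] = 0 ->
  (branch_poly a b)^`().[c] != 0.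
Proof.
move=> a0 b0 ab; rewrite horner_branch_poly => e.
rewrite horner_deriv_branch_poly.
have four0 : 2 ^+ 2 != 0 :> k by rewrite expf_neq0.
have := e; rewrite (_ : _ + _ = c * (c ^+ 4 - 1) * (b * c ^+ 4 - a)); last by ring.
move=> /eqP; rewrite mulf_eq0 [X in X || _ -> _]mulf_eq0 !subr_eq0 => /orP[/orP[]|]/eqP c0.
- by rewrite c0 !expr0n !mulr0 subr0 addr0.
- rewrite -[8%N]/(4 * 2)%N exprM c0; rewrite (_ : _ + _ = 2 ^+ 2 * (b - a)); last by ring.
  by rewrite mulf_neq0 // subr_eq0 eq_sym.
apply: contra_neq (mulf_neq0 four0 (mulf_neq0 a0 (_ : a - b != 0))) => [e0|].
  rewrite -[RHS](mulr0 b) -e0.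
  transitivity (b * a - 5 * (a + b) * (b * c ^+ 4) + 9 * (b * c ^+ 4) ^+ 2); last by ring.
  by rewrite c0; ring.
by rewrite subr_eq0.
Qed.

Lemma branch_poly_inv (L : fieldType) (a b u : L) : u != 0 ->
  (branch_poly b a).[u^-1] = (branch_poly a b).[u] / u ^+ 10.
Proof. by move=> u0; rewrite !horner_branch_poly; field. Qed.

End BranchPoly.

Section Differentials.
Variables (k : closedFieldType) (f : odd_degree_poly k).
Hypothesis two_neq0 : 2 != 0 :> k.
Variables (L : fieldType) (iota : {rmorphism k -> L}) (x y : L).
Local Notation "A ^i" := (map_poly iota A) (at level 2, format "A ^i").
Local Notation R := (coord_ring f).
Hypothesis yE : y ^+ 2 = (f^i).[x].
Hypothesis x_transc : forall c, x != iota c.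
Variable D : L -> L.
Hypothesis D_der : derivation_over iota D.
Hypotheses (Dx : D x = y *+ 2) (Dy : D y = (f^`()^i).[x]).

(** Where v vanishes, 2 v Dv = g'(u) Du allows the denominator v to be replaced by
g'(u), which is a unit. *)
Lemma differential_has_value (c e : k) (pE : e ^+ 2 = (map_poly idfun f).[c])
    (g : {poly k}) u v a b :
    v != 0 -> v ^+ 2 = (g^i).[u] -> (forall c, g.[c] = 0 -> g^`().[c] != 0) ->
    has_value yE pE u a -> has_value yE pE v b ->
  exists h, has_value yE pE (D u / v) h.
Proof.
move=> v0 vE g_sep ua vb.
have [b0|b0] := eqVneq b 0; last first.
  have [a' Dua] := has_value_deriv D_der Dx Dy ua.
  by exists (a' / b); apply: has_valueM => //; apply: has_valueV.
have ga : g.[a] = 0.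
  transitivity (b ^+ 2); last by rewrite b0 expr0n.
  apply: (has_value_inj x_transc (has_value_poly g ua)).
  by rewrite -vE; apply: has_valueX.
have g'a := has_value_poly g^`() ua.
have g'u0 : (g^`()^i).[u] != 0.
  apply: contraNneq (g_sep _ ga) => g'u; apply/eqP.
  apply: (has_value_inj x_transc g'a); rewrite g'u -(rmorph0 iota).
  exact: has_value_const.
have [b' Dvb] := has_value_deriv D_der Dx Dy vb.
exists (2 * b' / g^`().[a]).
suff -> : D u / v = iota 2 * D v / (g^`()^i).[u].
  apply: has_valueM; last exact: has_valueV (g_sep _ ga) g'a.
  by apply: has_valueM => //; apply: has_value_const.
have := congr1 D vE; rewrite (der_poly D_der) (derX D_der) => e2.
apply: (mulfI g'u0); rewrite mulrA -e2 rmorphMn rmorph1; field.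
by rewrite g'u0 v0.
Qed.

Variables a2 b2 : k.
Hypotheses (a2_neq0 : a2 != 0) (b2_neq0 : b2 != 0) (ab2 : a2 != b2).
Variables u v : L.
Hypotheses (u_neq0 : u != 0) (v_neq0 : v != 0).
Hypothesis vE : v ^+ 2 = ((branch_poly a2 b2)^i).[u].

(** At each affine point, either the affine coordinates u, v of the image or its
coordinates at infinity 1/u, v/u^5 are regular. *)
Definition maps_into_curve : Prop :=
  forall c e (pE : e ^+ 2 = (map_poly idfun f).[c]),
    (exists a b, has_value yE pE u a /\ has_value yE pE v b) \/
    (exists a b, has_value yE pE u^-1 a /\ has_value yE pE (v / u ^+ 5) b).

(** Near infinity, with u' = 1/u and v' = v/u^5, the identity
u^j Du/v = - u'^(3 - j) Du'/v' explains the bound on j. *)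
Lemma differential_coord j : maps_into_curve -> (j <= 3)%N ->
  exists p : R, D u * u ^+ j / v = coord_eval yE p.
Proof.
move=> regP j3; apply: (locally_regular_coord (yE := yE)) => // c e pE.
have [[a [b [ua vb]]]|[a [b [ua vb]]]] := regP c e pE.
  have [h Dh] : exists h, has_value yE pE (D u / v) h.
    by apply: (differential_has_value v_neq0 vE _ ua vb) => r; apply: branch_poly_separable.
  by exists (h * a ^+ j); rewrite mulrAC; apply: has_valueM => //; apply: has_valueX.
have v'0 : v / u ^+ 5 != 0 by rewrite mulf_neq0 ?invr_eq0 ?expf_neq0.
have v'E : (v / u ^+ 5) ^+ 2 = ((branch_poly b2 a2)^i).[u^-1].
  rewrite map_branch_poly branch_poly_inv // -map_branch_poly -vE; field.
  by [].
have [h Dh] : exists h, has_value yE pE (D u^-1 / (v / u ^+ 5)) h.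
  apply: (differential_has_value v'0 v'E _ ua vb) => r.
  by apply: branch_poly_separable; rewrite // eq_sym.
exists (-1 * (h * a ^+ (3 - j))).
have -> : D u * u ^+ j / v = iota (-1) * (D u^-1 / (v / u ^+ 5) * u^-1 ^+ (3 - j)).
  rewrite rmorphN1 (derV D_der) //.
  have : u ^+ j * u ^+ (3 - j) = u ^+ 3 by rewrite -exprD subnKC.
  have : u ^+ (3 - j) != 0 by rewrite expf_neq0.
  rewrite exprVn; move: (u ^+ (3 - j)) (u ^+ j) => w w' w0 ew.
  have -> : w' = u ^+ 3 / w by rewrite -ew mulfK.
  by field; rewrite w0 u_neq0 v_neq0.
apply: has_valueM; first exact: has_value_const.
by apply: has_valueM => //; apply: has_valueX.
Qed.

End Differentials.

(** * The two affine charts *)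

Lemma odd_branch_poly (k : fieldType) (a b : k) :
  b != 0 -> odd (size (branch_poly a b)).-1.
Proof. by move=> b0; rewrite size_branch_poly. Qed.

Definition branch_odd_poly (k : fieldType) (a b : k) (b0 : b != 0) : odd_degree_poly k :=
  OddDegreePoly (odd_branch_poly a b0).

Section Moebius.
Variable k : closedFieldType.
Variables (a1 b1 : k) (a1_neq0 : a1 != 0) (b1_neq0 : b1 != 0).
Local Notation f := (branch_odd_poly a1 b1_neq0).
Local Notation f' := (branch_odd_poly b1 a1_neq0).
Variables (K : fieldType) (iota : {rmorphism k -> K}) (x y : K).
Local Notation "A ^i" := (map_poly iota A) (at level 2, format "A ^i").
Hypothesis yE : y ^+ 2 = (f^i).[x].
Hypothesis x_transc : forall c, x != iota c.

Let x_neq0 : x != 0. Proof. by rewrite -(rmorph0 iota). Qed.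

Lemma chart_infty_eq : (y / x ^+ 5) ^+ 2 = (f'^i).[x^-1].
Proof.
rewrite /= map_branch_poly branch_poly_inv // -map_branch_poly -yE; field.
by [].
Qed.

Lemma chart_infty_transc c : x^-1 != iota c.
Proof.
apply: contra_neq (x_transc c^-1) => e.
by rewrite fmorphV -e invrK.
Qed.

(** X^n A(1/X). *)
Definition poly_rev n (A : {poly k}) : {poly k} := \poly_(i < n.+1) A`_(n - i).

Lemma size_poly_rev n A : (size (poly_rev n A) <= n.+1)%N.
Proof. exact: size_poly. Qed.

Lemma horner_poly_rev n (A : {poly k}) : (size A <= n.+1)%N ->
  ((poly_rev n A)^i).[x] = x ^+ n * (A^i).[x^-1].
Proof.
move=> sA; rewrite (@horner_coef_wide _ n.+1); last first.
  by rewrite size_map_poly size_poly.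
rewrite (@horner_coef_wide _ n.+1 A^i) ?size_map_poly // mulr_sumr.
rewrite (reindex_inj rev_ord_inj) /=; apply: eq_bigr => i _.
have lein : (i <= n)%N by rewrite -ltnS.
have -> : (n.+1 - i.+1)%N = (n - i)%N by rewrite subSS.
rewrite !coef_map coef_poly ltnS leq_subr subKn // mulrCA; congr (_ * _).
have -> : x ^+ n = x ^+ (n - i) * x ^+ i by rewrite -exprD subnK.
by rewrite exprVn mulfK // expf_neq0.
Qed.

(** A polynomial in x equal to x^3 times a polynomial in 1/x has degree at most 3. The
y-components satisfy B(x) = - x^(-2) C(1/x), which has no nonzero solution in
polynomials B and C. *)
Lemma two_charts (p : coord_ring f) (q : coord_ring f') :
    coord_eval yE p = - x ^+ 3 * coord_eval chart_infty_eq q ->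
  p.2 = 0 /\ (size p.1 <= 4)%N.
Proof.
move=> e; pose n := (size q.1 + size q.2)%N.
have rev1 := @horner_poly_rev n q.1 (leqW (leq_addr _ _)).
have rev2 := @horner_poly_rev n q.2 (leqW (leq_addl _ _)).
have eqp : coord_eval yE ('X^(n + 2) * p.1, 'X^(n + 2) * p.2) =
           coord_eval yE (- 'X^5 * poly_rev n q.1, - poly_rev n q.2).
  move: e; rewrite /coord_eval /= !(rmorphM, rmorphN) /= !map_polyXn.
  rewrite ?map_polyX !(hornerM, hornerN) !hornerXn ?hornerX rev1 rev2 exprD => e.
  transitivity (x ^+ n * x ^+ 2 * ((p.1^i).[x] + (p.2^i).[x] * y)); first by ring.
  by rewrite e; field.
have [e1 e2] : 'X^(n + 2) * p.1 = - 'X^5 * poly_rev n q.1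
         /\ 'X^(n + 2) * p.2 = - poly_rev n q.2.
  by have [] := coord_eval_inj x_transc eqp.
have szX (A : {poly k}) m : A != 0 -> size ('X^m * A) = (m + size A)%N.
  by move=> A0; rewrite size_monicM ?monicXn // size_polyXn.
split.
  apply/eqP/negPn/negP => /(szX _ (n + 2)%N).
  rewrite e2 size_polyN => sz; have := size_poly_rev n q.2; rewrite sz; lia.
have [->|p10] := eqVneq p.1 0; first by rewrite size_poly0.
have := szX _ (n + 2)%N p10; rewrite e1 mulNr size_polyN => sz.
have := size_polyMleq 'X^5 (poly_rev n q.1); rewrite sz size_polyXn.
have arith m s b : (b <= m.+1)%N -> (m + 2 + s <= (6 + b).-1)%N -> (s <= 4)%N by lia.
exact: arith (size_poly_rev n q.1).
Qed.

End Moebius.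

(** * From regular differentials to a Moebius map *)

(** With A1 / A0 = Q / P in lowest terms, A3 = A0 (Q / P)^3 shows that P^3 divides A0,
and the quotient e then satisfies A3 = Q^3 e. *)
Lemma cube_ratio_linear (k : fieldType) (A0 A1 A3 : {poly k}) :
    A0 != 0 -> A1 != 0 -> A0 ^+ 2 * A3 = A1 ^+ 3 ->
    (size A0 <= 4)%N -> (size A3 <= 4)%N ->
  exists P Q e : {poly k}, [/\ A0 = P ^+ 3 * e, A1 = P ^+ 2 * Q * e,
    (size P <= 2)%N, (size Q <= 2)%N
    & (1 < size P)%N || (1 < size Q)%N -> size e = 1%N].
Proof.
move=> A00 A10 e13 s0 s3.
pose G := gcdp A0 A1; pose P := A0 %/ G; pose Q := A1 %/ G.
have eP : A0 = P * G by rewrite divpK // dvdp_gcdl.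
have eQ : A1 = Q * G by rewrite divpK // dvdp_gcdr.
have coPQ : coprimep P Q by apply: coprimep_div_gcd; rewrite A00.
have PN0 : P != 0 by apply: contraNneq A00 => P0; rewrite eP P0 mul0r.
have QN0 : Q != 0 by apply: contraNneq A10 => Q0; rewrite eQ Q0 mul0r.
have GN0 : G != 0 by apply: contraNneq A00 => G0; rewrite eP G0 mulr0.
have eG : P ^+ 2 * A3 = Q ^+ 3 * G.
  apply: (mulfI (expf_neq0 2 GN0)).
  transitivity (A0 ^+ 2 * A3); first by rewrite eP; ring.
  by rewrite e13 eQ; ring.
have /dvdpP[e ee] : P ^+ 2 %| G.
  rewrite -(@Gauss_dvdpr _ _ (Q ^+ 3)); first by rewrite -eG dvdp_mulr.
  by rewrite coprimep_expl // coprimep_expr.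
have eN0 : e != 0 by apply: contraNneq GN0 => e0; rewrite ee e0 mul0r.
have e3 : A3 = Q ^+ 3 * e.
  by apply: (mulfI (expf_neq0 2 PN0)); rewrite eG ee; ring.
have szX3 (S : {poly k}) : S != 0 -> size (S ^+ 3 * e) = ((size S).-1 * 3 + size e)%N.
  move=> S0; have S3 := expf_neq0 3 S0; rewrite size_mul // -size_exp.
  by rewrite -[size (S ^+ 3)]prednK ?size_poly_gt0.
have eA0 : A0 = P ^+ 3 * e by rewrite eP ee; ring.
have := szX3 _ PN0; have := szX3 _ QN0; rewrite -e3 -eA0 => sQ sP.
have : (0 < size e)%N by rewrite size_poly_gt0.
have : (0 < size P)%N by rewrite size_poly_gt0.
have : (0 < size Q)%N by rewrite size_poly_gt0.
rewrite sQ in s3; rewrite sP in s0 => Q1 P1 e1.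
by exists P, Q, e; split=> //; [rewrite eQ ee; ring | lia..].
Qed.

Lemma size2_linear (k : fieldType) (P : {poly k}) :
  (size P <= 2)%N -> P = P`_1 *: 'X + (P`_0)%:P.
Proof.
move=> sP; apply/polyP=> -[|[|i]]; rewrite coefD coefZ coefX coefC /=.
- by rewrite mulr0 add0r.
- by rewrite mulr1 addr0.
- by rewrite mulr0 addr0 nth_default // (leq_trans sP).
Qed.

Lemma map_branch_form (R S : comNzRingType) (g : {rmorphism R -> S}) (a b X Z : R) :
  g (branch_form a b X Z) = branch_form (g a) (g b) (g X) (g Z).
Proof. by rewrite /branch_form !(rmorphM, rmorphB, rmorphXn). Qed.

Lemma horner_branch_form (R : comNzRingType) (a b X Z : {poly R}) c :
  (branch_form a b X Z).[c] = branch_form a.[c] b.[c] X.[c] Z.[c].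
Proof. exact: (map_branch_form (horner_eval c)). Qed.

Section Moebius.
Variable k : closedFieldType.
Hypothesis two_neq0 : 2 != 0 :> k.
Variables (a1 b1 : k) (a1_neq0 : a1 != 0) (b1_neq0 : b1 != 0).
Local Notation f := (branch_odd_poly a1 b1_neq0).
Local Notation f' := (branch_odd_poly b1 a1_neq0).
Variables (K : fieldType) (iota : {rmorphism k -> K}) (x y : K).
Local Notation "A ^i" := (map_poly iota A) (at level 2, format "A ^i").
Hypothesis yE : y ^+ 2 = (f^i).[x].
Hypothesis x_transc : forall c, x != iota c.
Variable D : K -> K.
Hypothesis D_der : derivation_over iota D.
Hypotheses (Dx : D x = y *+ 2) (Dy : D y = (f^`()^i).[x]).

Variables a2 b2 : k.
Hypotheses (a2_neq0 : a2 != 0) (b2_neq0 : b2 != 0) (ab2 : a2 != b2).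
Variables u v : K.
Hypothesis Du_neq0 : D u != 0.
Hypothesis vE : v ^+ 2 = ((branch_poly a2 b2)^i).[u].
Hypothesis reg1 : maps_into_curve yE u v.
Hypothesis reg2 :
  maps_into_curve (chart_infty_eq a1_neq0 yE x_transc) u v.

Let x_neq0 : x != 0. Proof. by rewrite -(rmorph0 iota). Qed.

(** The derivation 2w d/dt on the chart t = 1/x, w = y/x^5. *)
Definition deriv_infty (z : K) : K := - x ^- 3 * D z.

Lemma deriv_infty_der : derivation_over iota deriv_infty.
Proof.
split=> [a b|a b|c]; rewrite /deriv_infty.
- by rewrite (derD D_der) mulrDr.
- by rewrite (derM D_der); ring.
- by rewrite (derC D_der) mulr0.
Qed.

Lemma deriv_infty_x : deriv_infty x^-1 = (y / x ^+ 5) *+ 2.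
Proof. by rewrite /deriv_infty (derV D_der) // Dx; field. Qed.

Lemma deriv_infty_y : deriv_infty (y / x ^+ 5) = (f'^`()^i).[x^-1].
Proof.
rewrite /deriv_infty (der_div D_der) ?expf_neq0 // (derX D_der) Dx Dy.
have -> : (y *+ 2 * x ^+ 4 *+ 5) = y * (10 * x ^+ 4) by ring.
rewrite [y * (y * _)]mulrA -expr2 yE /= -!deriv_map !map_branch_poly.
rewrite !horner_deriv_branch_poly !horner_branch_poly; field.
by [].
Qed.

Lemma u_nonconst c : u != iota c.
Proof. by apply: contraNneq Du_neq0 => ->; rewrite (derC D_der). Qed.

Let u_neq0 : u != 0. Proof. by rewrite -(rmorph0 iota) u_nonconst. Qed.

Let v_neq0 : v != 0.
Proof.
apply/eqP=> v0; move: vE; rewrite v0 expr0n => /esym e.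
have := horner_transc_eq0 u_nonconst e => /(congr1 (size \o @polyseq k)) /=.
by rewrite size_branch_poly // size_poly0.
Qed.

(** The same differential is regular on both charts, and changes there by the factor
-x^(-3) relating the two derivations. *)
Lemma differential_poly j : (j <= 3)%N ->
  exists2 A : {poly k}, (size A <= 4)%N & D u * u ^+ j / v = (A^i).[x].
Proof.
move=> j3.
have [p pE] := differential_coord two_neq0 x_transc D_der Dx Dy
  a2_neq0 b2_neq0 ab2 u_neq0 v_neq0 vE reg1 j3.
have [q qE] := differential_coord two_neq0 (chart_infty_transc x_transc)
  deriv_infty_der deriv_infty_x deriv_infty_y
  a2_neq0 b2_neq0 ab2 u_neq0 v_neq0 vE reg2 j3.
have [|p2 sp1] := @two_charts k a1 b1 a1_neq0 b1_neq0 K iota x y yE x_transc p q.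
  rewrite -pE -qE /deriv_infty; field.
  by rewrite v_neq0 x_neq0.
by exists p.1; rewrite // pE /coord_eval p2 rmorph0 hornerC mul0r addr0.
Qed.

(** The constant is 4 del^2 / d^2, where del is the determinant of the Moebius map and d
is the constant by which Du/v differs from P^3: indeed Du = 2y del / P^2, hence
v = 2y del / (d P^5), and squaring gives v^2 = g(u). *)
Lemma moebius_of_maps_into_curve : exists al be ga et c : k,
  [/\ al * et != be * ga, c != 0 &
    branch_form a2%:P b2%:P (al *: 'X + be%:P) (ga *: 'X + et%:P) =
      c *: branch_poly a1 b1].
Proof.
have [A0 s0 e0] := differential_poly (leq0n 3).
have [A1 s1 e1] := @differential_poly 1 isT.
have [A3 s3 e3] := @differential_poly 3 isT.
rewrite expr0 mulr1 in e0; rewrite expr1 in e1.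
have h0 : D u / v != 0 by rewrite mulf_neq0 ?invr_eq0.
have A00 : A0 != 0 by apply: contraNneq h0 => A00; rewrite e0 A00 rmorph0 horner0.
have A10 : A1 != 0.
  apply: contraNneq (mulf_neq0 h0 u_neq0) => A10.
  by rewrite mulrAC e1 A10 rmorph0 horner0.
have e13 : A0 ^+ 2 * A3 = A1 ^+ 3.
  apply/eqP; rewrite -subr_eq0; apply/eqP/(horner_transc_eq0 x_transc).
  rewrite rmorphB rmorphM !rmorphXn /= hornerD hornerN hornerM !horner_exp.
  by rewrite -e0 -e1 -e3; field.
have [P [Q [e [eA0 eA1 sP sQ se]]]] := cube_ratio_linear A00 A10 e13 s0 s3.
have [eP eQ] := (size2_linear sP, size2_linear sQ).
exists Q`_1, Q`_0, P`_1, P`_0.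
have PN0 : (P^i).[x] != 0.
  apply: contraNneq A00 => P0; rewrite eA0.
  by rewrite (horner_transc_eq0 x_transc P0) expr0n mul0r.
have eN0 : (e^i).[x] != 0.
  apply: contraNneq A00 => E0; rewrite eA0.
  by rewrite (horner_transc_eq0 x_transc E0) mulr0.
have A0E : (A0^i).[x] = (P^i).[x] ^+ 3 * (e^i).[x].
  by rewrite eA0 rmorphM rmorphXn hornerM horner_exp.
have A1E : (A1^i).[x] = (P^i).[x] ^+ 2 * (Q^i).[x] * (e^i).[x].
  by rewrite eA1 2!rmorphM rmorphXn 2!hornerM horner_exp.
have uE : u = (Q^i).[x] / (P^i).[x].
  have -> : u = (A1^i).[x] / (A0^i).[x] by rewrite -e0 -e1; field; rewrite v_neq0 Du_neq0.
  by rewrite A0E A1E; field; rewrite PN0 eN0.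
have size_e : size e = 1%N.
  apply: se; apply: contraNT Du_neq0; rewrite negb_or -!leqNgt => /andP[P1 Q1].
  rewrite uE (size1_polyC P1) (size1_polyC Q1) !map_polyC !hornerC -fmorph_div.
  by rewrite (derC D_der).
have [|d dN0 ed] := size_poly1P e _; first by rewrite size_e.
pose del := Q`_1 * P`_0 - Q`_0 * P`_1.
have DuE : D u = iota del * (y *+ 2) / (P^i).[x] ^+ 2.
  rewrite uE (der_div D_der) // !(der_poly D_der) Dx; congr (_ / _).
  rewrite eP eQ !derivD !derivZ !derivX !derivC !addr0.
  rewrite !rmorphD /= !map_polyZ !map_polyC !map_polyX /= rmorph1 rmorphN !rmorphM.
  rewrite !hornerD !hornerZ !hornerC !hornerX /=; ring.
have delN0 : del != 0.
  by apply: contraNneq Du_neq0 => del0; rewrite DuE del0 rmorph0 !mul0r.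
have vE' : v = iota del * (y *+ 2) / ((P^i).[x] ^+ 5 * iota d).
  have -> : v = D u / (A0^i).[x] by rewrite -e0; field; rewrite v_neq0 Du_neq0.
  rewrite DuE A0E ed map_polyC hornerC; field.
  by rewrite PN0 fmorph_eq0 dN0.
exists (2 ^+ 2 * del ^+ 2 / d ^+ 2); split.
- by rewrite -subr_eq0.
- by rewrite !mulf_neq0 ?invr_eq0 ?expf_neq0.
rewrite -eP -eQ; apply/eqP; rewrite -subr_eq0; apply/eqP/(horner_transc_eq0 x_transc).
apply/eqP; rewrite rmorphB /= hornerD hornerN subr_eq0; apply/eqP.
rewrite map_polyZ hornerZ -yE.
have -> : (branch_form a2%:P b2%:P Q P)^i.[x] = (P^i).[x] ^+ 10 * v ^+ 2.
  rewrite vE map_branch_poly horner_branch_poly uE map_branch_form horner_branch_form.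
  by rewrite /= !map_polyC !hornerC branch_form_sum; field.
rewrite vE' fmorph_div rmorphM !rmorphXn /= rmorphMn rmorph1; field.
by rewrite PN0 fmorph_eq0 dN0.
Qed.

End Moebius.

(** * Homogeneous coordinates on the projective curve *)

Section FormEvaluation.
Variables (k : comNzRingType) (n : nat).

Lemma eq_mmap (S : comNzRingType) (h h' : k -> S) (w w' : 'I_n -> S) (F : {mpoly k[n]}) :
  h =1 h' -> w =1 w' -> mmap h w F = mmap h' w' F.
Proof.
move=> eh ew; apply: eq_bigr => m _; rewrite eh; congr (_ * _).
by apply: eq_bigr => i _; rewrite ew.
Qed.

Lemma rmorph_mmap (S T : comNzRingType) (g : {rmorphism S -> T}) (h : k -> S)
    (w : 'I_n -> S) (F : {mpoly k[n]}) :
  g (mmap h w F) = mmap (g \o h) (g \o w) F.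
Proof.
rewrite /mmap rmorph_sum; apply: eq_bigr => m _; rewrite rmorphM; congr (_ * _).
by rewrite /mmap1 rmorph_prod; apply: eq_bigr => i _; rewrite rmorphXn.
Qed.

Lemma mmap_homog (S : comNzRingType) (h : k -> S) (w : 'I_n -> S) (c : S)
    d (F : {mpoly k[n]}) : F \is d.-homog ->
  mmap h (fun i => c * w i) F = c ^+ d * mmap h w F.
Proof.
move=> /dhomogP Fd; rewrite /mmap mulr_sumr big_seq [RHS]big_seq.
apply: eq_bigr => m mF; rewrite mulrCA; congr (_ * _).
have := Fd m mF; rewrite /= mdegE => <-.
rewrite expr_sum /mmap1 -big_split /=.
by apply: eq_bigr => i _; rewrite exprMn.
Qed.
End FormEvaluation.

Section HomogeneousCoordinates.
Variables (k : fieldType) (n : nat).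
Implicit Types (P Q : proj_space k n) (v w : 'rV[k]_n.+1).

Lemma hcoords_neq0 P v : hcoords P v -> v != 0.
Proof.
by move=> Pv; have := valP P; rewrite /= (Pv : val P = _) dim_vline; case: (v != 0).
Qed.

Lemma hcoords_exist v : v != 0 -> exists P, hcoords P v.
Proof.
move=> v0; have d1 : \dim <[v]> == 1%N by rewrite dim_vline v0.
by exists (exist (fun L : {vspace 'rV[k]_n.+1} => \dim L == 1%N) _ d1).
Qed.

Lemma hcoords_vpick P : hcoords P (vpick (val P)).
Proof.
have /eqP P1 := valP P.
have P0 : vpick (val P) != 0.
  by rewrite vpick0 -dimv_eq0 P1.
apply/eqP; rewrite eq_sym eqEdim -memvE memv_pick dim_vline P0.
by rewrite /= P1.
Qed.

Lemma hcoords_uniq P Q v : hcoords P v -> hcoords Q v -> P = Q.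
Proof. by move=> Pv Qv; apply: val_inj; rewrite Pv Qv. Qed.

Lemma hcoords_scale P v w : hcoords P v -> hcoords P w ->
  exists2 c, c != 0 & w = c *: v.
Proof.
move=> Pv Pw; have : w \in <[v]>%VS by rewrite -Pv Pw memv_line.
case/vlineP=> c e; exists c => //; apply: contraNneq (hcoords_neq0 Pw) => c0.
by rewrite e c0 scale0r.
Qed.

Lemma scale_hcoords P v c : c != 0 -> hcoords P v -> hcoords P (c *: v).
Proof.
move=> c0; rewrite /hcoords => ->; apply/eqP; rewrite eqEsubv -!memvE.
by rewrite (memvZ _ (memv_line _)) -{1}(scalerK c0 v) memvZ ?memv_line.
Qed.

Lemma hcoords_vanish P v d (F : {mpoly k[n.+1]}) :
  F \is d.-homog -> hcoords P v -> F.@[v 0] = 0 -> vanishes_at F P.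
Proof.
move=> Fd Pv F0 w Pw; have [c _ ->] := hcoords_scale Pv Pw.
have -> : F.@[(c *: v) 0] = F.@[fun i => c * v 0 i].
  by apply: eq_mmap => // i; rewrite mxE.
by rewrite /meval (mmap_homog _ _ _ Fd) [mmap _ _ _]F0 mulr0.
Qed.

End HomogeneousCoordinates.

Definition hyper_coords (R : nzRingType) (x y : R) (i : 'I_7) : R :=
  if (i < 6)%N then x ^+ i else y.

(** The coordinates of the chart at infinity, where t = 1/x and w = y/x^5. *)
Definition infty_coords (R : nzRingType) (t w : R) (i : 'I_7) : R :=
  if (i < 6)%N then t ^+ (5 - i) else w.

Section HyperellipticPoints.
Variables (k : closedFieldType) (a b : k) (a_neq0 : a != 0) (b_neq0 : b != 0).
Local Notation f := (branch_odd_poly a b_neq0).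
Local Notation f' := (branch_odd_poly b a_neq0).
Local Notation X := (@hyperelliptic_curve k 4 (branch_poly a b)).

Lemma affine_point c e : e ^+ 2 = (map_poly idfun f).[c] ->
  exists2 P, X P & hcoords P (\row_i hyper_coords c e i).
Proof.
rewrite map_poly_id // => ce.
have [|P Pv] := @hcoords_exist k 6 (\row_i hyper_coords c e i).
  apply/eqP=> /rowP/(_ ord0); rewrite !mxE /hyper_coords /= expr0 => /eqP.
  by rewrite oner_eq0.
exists P => // d F _; apply; exists c, e; split=> //.
Qed.

Definition restrict_form (g : odd_degree_poly k)
    (w : 'I_7 -> coord_ring g) (F : {mpoly k[7]}) : coord_ring g :=
  mmap (coord_const g) w F.

Lemma eval_restrict_form (g : odd_degree_poly k) (L : comNzRingType)
    (iota : {rmorphism k -> L}) (x y : L) (yE : y ^+ 2 = (map_poly iota g).[x])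
    w F :
  coord_eval yE (restrict_form w F) = mmap iota (fun i => coord_eval yE (w i)) F.
Proof.
rewrite [LHS]rmorph_mmap; apply: eq_mmap => // c; exact: coord_eval_const.
Qed.

Lemma rmorph_hyper_coords (S T : comNzRingType) (h : {rmorphism S -> T}) x y i :
  h (hyper_coords x y i) = hyper_coords (h x) (h y) i.
Proof. by rewrite /hyper_coords; case: ifP; rewrite ?rmorphXn. Qed.

Lemma rmorph_infty_coords (S T : comNzRingType) (h : {rmorphism S -> T}) x y i :
  h (infty_coords x y i) = infty_coords (h x) (h y) i.
Proof. by rewrite /infty_coords; case: ifP; rewrite ?rmorphXn. Qed.

Lemma infty_coordsE (L : fieldType) (t w : L) i : t != 0 ->
  infty_coords t w i = t ^+ 5 * hyper_coords t^-1 (w / t ^+ 5) i.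
Proof.
move=> t0; rewrite /infty_coords /hyper_coords; case: ifP => [i6|_].
  have -> : t ^+ 5 = t ^+ (5 - i) * t ^+ i by rewrite -exprD subnK.
  by rewrite exprVn mulfK // expf_neq0.
by rewrite mulrCA mulfV ?mulr1 // expf_neq0.
Qed.

(** A form vanishing on the affine curve restricts to an element of the coordinate
ring of the chart at infinity that vanishes wherever t != 0. After multiplication by
t it vanishes everywhere, so it is zero because the ring is a domain. *)
Lemma infinity_point t w : w ^+ 2 = (map_poly idfun f').[t] ->
  exists2 P, X P & hcoords P (\row_i infty_coords t w i).
Proof.
move=> tw.
have [|P Pv] := @hcoords_exist k 6 (\row_i infty_coords t w i).
  apply/eqP=> /rowP/(_ (Ordinal (isT : (5 < 7)%N))).
  by rewrite !mxE /infty_coords /= expr0 => /eqP; rewrite oner_eq0.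
exists P => // d F Fd Fvan; apply: (hcoords_vanish Fd Pv).
pose Fr := restrict_form (infty_coords (coord_x f') (coord_y f')) F.
have FrE c e (pE : e ^+ 2 = (map_poly idfun f').[c]) :
    coord_eval pE Fr = F.@[fun i => infty_coords c e i].
  rewrite eval_restrict_form; apply: eq_mmap => // i.
  by rewrite rmorph_infty_coords /= coord_eval_x coord_eval_y.
have Fr0 : Fr = 0.
  suff : coord_x f' * Fr = 0.
    move/eqP; rewrite mulf_eq0 => /orP[|/eqP//] /eqP[] /eqP.
    by rewrite polyX_eq0.
  apply: coord_vanish => c e pE; rewrite rmorphM /= coord_eval_x FrE.
  have [->|c0] := eqVneq c 0; first by rewrite mul0r.
  have ce : (e / c ^+ 5) ^+ 2 = (map_poly idfun f).[c^-1].
    rewrite map_poly_id // branch_poly_inv //.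
    by move: pE; rewrite map_poly_id // => <-; field.
  have [Q XQ Qv] := affine_point ce.
  have Q0 : F.@[fun i => hyper_coords c^-1 (e / c ^+ 5) i] = 0.
    rewrite -[RHS](XQ d F Fd Fvan _ Qv).
    by apply: eq_mmap => // i; rewrite mxE.
  rewrite -[F.@[_]](@eq_mmap _ _ _ idfun idfun (fun i => c ^+ 5 * hyper_coords c^-1 (e / c ^+ 5) i)) //; last first.
    by move=> i; rewrite infty_coordsE.
  by rewrite (mmap_homog _ _ _ Fd) [mmap _ _ _]Q0 !mulr0.
transitivity (F.@[fun i => infty_coords t w i]).
  by apply: eq_mmap => // i; rewrite mxE.
by rewrite -(FrE _ _ tw) Fr0 rmorph0.
Qed.

End HyperellipticPoints.

(** * Equations of the curve, and restriction of forms *)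

Notation "''o_' n" := (Ordinal (isT : (n < 7)%N)) (at level 8, n at level 2).

Section CurveEquations.
Variables (k : fieldType) (a b : k).
Local Notation X := (@hyperelliptic_curve k 4 (branch_poly a b)).

(** The rational normal curve of degree 5 in the first six coordinates, and the
equation y^2 = f(x) in degree 2. The ring is arbitrary because these equations are used
for points, for elements of coordinate rings and in the function field. *)
Definition curve_equations (R : comNzRingType) (a b : R) (w : 'I_7 -> R) : Prop :=
  (forall i j i' j' : 'I_7, (i < 6)%N -> (j < 6)%N -> (i' < 6)%N -> (j' < 6)%N ->
     (i + j = i' + j')%N -> w i * w j = w i' * w j') /\
  w 'o_6 ^+ 2 = a * (w 'o_0 * w 'o_1) - (a + b) * (w 'o_0 * w 'o_5)
                + b * (w 'o_4 * w 'o_5).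

Lemma hyper_coords_equations (R : comNzRingType) (c d x y : R) :
  y ^+ 2 = (branch_poly c d).[x] -> curve_equations c d (hyper_coords x y).
Proof.
move=> e; split=> [i j i' j' i6 j6 i'6 j'6 eij|].
  by rewrite /hyper_coords i6 j6 i'6 j'6 -!exprD eij.
by rewrite /hyper_coords /= e horner_branch_poly; ring.
Qed.

Lemma scale_equations (R : comNzRingType) (c d r : R) w :
  curve_equations c d w -> curve_equations c d (fun i => r * w i).
Proof.
move=> [q s]; split=> [i j i' j' i6 j6 i'6 j'6 eij|].
  by rewrite mulrACA (q i j i' j') // mulrACA.
by rewrite exprMn s; ring.
Qed.

Lemma curve_point_equations P w : X P -> hcoords P w ->
  curve_equations a b (w 0).
Proof.
move=> XP Pw.
have homX i j : ('X_i * 'X_j : {mpoly k[7]}) \is 2.-homog.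
  have homX1 l : ('X_l : {mpoly k[7]}) \is 1.-homog by rewrite dhomogX /= mdeg1.
  exact: dhomogM (homX1 i) (homX1 j).
have van (F : {mpoly k[7]}) : F \is 2.-homog ->
    (forall x y, y ^+ 2 = (branch_poly a b).[x] -> F.@[hyper_coords x y] = 0) ->
    F.@[w 0] = 0.
  move=> Fh F0; apply: (XP _ F Fh) => // Q [x [y [xy Qv]]].
  refine (hcoords_vanish Fh Qv _); rewrite -[RHS](F0 _ _ xy).
  by apply: eq_mmap => // i; rewrite mxE.
split=> [i j i' j' i6 j6 i'6 j'6 eij|].
  have := van ('X_i * 'X_j - 'X_i' * 'X_j').
  rewrite mevalB !mevalM !mevalXU => e; apply/eqP; rewrite -subr_eq0; apply/eqP.
  apply: e; first by rewrite rpredB.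
  move=> x y /hyper_coords_equations[q _]; rewrite mevalB !mevalM !mevalXU.
  by rewrite (q i j i' j') // subrr.
pose Z i : {mpoly k[7]} := 'X_i.
pose F := Z 'o_6 * Z 'o_6 - (a *: (Z 'o_0 * Z 'o_1)
   - (a + b) *: (Z 'o_0 * Z 'o_5) + b *: (Z 'o_4 * Z 'o_5)).
have FE (v : 'I_7 -> k) : F.@[v] = v 'o_6 ^+ 2 - (a * (v 'o_0 * v 'o_1)
   - (a + b) * (v 'o_0 * v 'o_5) + b * (v 'o_4 * v 'o_5)).
  by rewrite /F !(mevalB, mevalD) !mevalZ !mevalM /Z !mevalXU expr2.
apply/eqP; rewrite -subr_eq0 -FE; apply/eqP; apply: van.
  by rewrite /F /Z !(rpredB, rpredD, rpredZ, homX).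
by move=> x y /hyper_coords_equations[_ s]; rewrite FE s subrr.
Qed.

(** The equations w_i^2 = w_(i-1) w_(i+1) propagate the zero, so that the curve has a
single point outside the affine chart. *)
Lemma curve_equations_infinity (w : 'I_7 -> k) : curve_equations a b w ->
  w 'o_0 = 0 -> forall i, i != 'o_5 -> w i = 0.
Proof.
move=> [q s] w0.
have w1 : w 'o_1 = 0.
  by apply/eqP; rewrite -sqrf_eq0 expr2 (q _ _ 'o_0 'o_2) // w0 mul0r.
have w2 : w 'o_2 = 0.
  by apply/eqP; rewrite -sqrf_eq0 expr2 (q _ _ 'o_1 'o_3) // w1 mul0r.
have w3 : w 'o_3 = 0.
  by apply/eqP; rewrite -sqrf_eq0 expr2 (q _ _ 'o_2 'o_4) // w2 mul0r.
have w4 : w 'o_4 = 0.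
  by apply/eqP; rewrite -sqrf_eq0 expr2 (q _ _ 'o_3 'o_5) // w3 mul0r.
have w6 : w 'o_6 = 0.
  by apply/eqP; rewrite -sqrf_eq0 s w0 w4 !mul0r !mulr0 subr0 addr0.
have wE (i j : 'I_7) : val i = val j -> w i = w j by move/val_inj->.
case=> -[|[|[|[|[|[|[|m]]]]]]] // lt_m i5.
- by rewrite (wE _ 'o_0).
- by rewrite (wE _ 'o_1).
- by rewrite (wE _ 'o_2).
- by rewrite (wE _ 'o_3).
- by rewrite (wE _ 'o_4).
- by rewrite (wE _ 'o_6).
Qed.

End CurveEquations.

Section Restriction.
Variables (k : closedFieldType) (a1 b1 a2 b2 : k).
Variables (a1_neq0 : a1 != 0) (b1_neq0 : b1 != 0).
Local Notation f := (branch_odd_poly a1 b1_neq0).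
Local Notation X := (@hyperelliptic_curve k 4 (branch_poly a1 b1)).
Local Notation Y := (@hyperelliptic_curve k 4 (branch_poly a2 b2)).
Variable phi : proj_space k 6 -> proj_space k 6.
Hypothesis phiXY : forall P, X P -> Y (phi P).

(** The property of the forms F in [regular_on] that does not depend on the point
around which they describe phi. *)
Definition represents (F : 'I_7 -> {mpoly k[7]}) : Prop :=
  forall Q v, X Q -> hcoords Q v -> mpoly_map F v != 0 ->
    hcoords (phi Q) (mpoly_map F v).

Definition affine_forms (F : 'I_7 -> {mpoly k[7]}) (i : 'I_7) : coord_ring f :=
  restrict_form (hyper_coords (coord_x f) (coord_y f)) (F i).

Lemma eval_affine_forms F i c e (pE : e ^+ 2 = (map_poly idfun f).[c]) :
  coord_eval pE (affine_forms F i) =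
    mpoly_map F (\row_i hyper_coords c e i) 0 i.
Proof.
rewrite mxE eval_restrict_form; apply: eq_mmap => // j.
by rewrite mxE rmorph_hyper_coords /= coord_eval_x coord_eval_y.
Qed.

(** The equations hold at each affine point, trivially where all forms vanish. *)
Lemma affine_forms_equations F : represents F ->
  curve_equations (coord_const f a2) (coord_const f b2) (affine_forms F).
Proof.
move=> repF.
have pt c e (pE : e ^+ 2 = (map_poly idfun f).[c]) :
    curve_equations a2 b2 (fun i => coord_eval pE (affine_forms F i)).
  have [P XP Pv] := affine_point pE.
  set v := \row_i _ in Pv.
  suff : curve_equations a2 b2 (mpoly_map F v 0).
    move=> [q s]; split=> [i j i' j' *|]; rewrite !eval_affine_forms //.
    exact: q.
  have [->|Fv] := eqVneq (mpoly_map F v) 0.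
    by split=> [*|]; rewrite !mxE ?(mulr0, mul0r, expr0n, subr0, addr0).
  by apply: curve_point_equations (phiXY XP) _; apply: repF.
split=> [i j i' j' i6 j6 i'6 j'6 eij|]; apply/eqP; rewrite -subr_eq0; apply/eqP;
  apply: coord_vanish => c e pE; have [q s] := pt c e pE.
  by rewrite rmorphB !rmorphM /= (q i j i' j') // subrr.
rewrite rmorphB rmorphXn /= s; apply/eqP; rewrite subr_eq0; apply/eqP.
by rewrite !(rmorphD, rmorphB, rmorphN, rmorphM) /= !coord_eval_const.
Qed.

(** At each affine point the two families are coordinates of the same image, or one of
them vanishes. *)
Lemma affine_forms_proportional F F' i j : represents F -> represents F' ->
  affine_forms F i * affine_forms F' j = affine_forms F j * affine_forms F' i.
Proof.
move=> repF repF'; apply/eqP; rewrite -subr_eq0; apply/eqP.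
apply: coord_vanish => c e pE; have [P XP Pv] := affine_point pE.
rewrite rmorphB !rmorphM /= !eval_affine_forms; set v := \row_i _ in Pv *.
have [F0|F0] := eqVneq (mpoly_map F v) 0; first by rewrite F0 !mxE !mul0r subrr.
have [F'0|F'0] := eqVneq (mpoly_map F' v) 0; first by rewrite F'0 !mxE !mulr0 subrr.
have [r _ ->] := hcoords_scale (repF _ _ XP Pv F0) (repF' _ _ XP Pv F'0).
by rewrite !mxE; ring.
Qed.

End Restriction.

(** * An isomorphism yields a Moebius map *)

Lemma rmorph_equations (R S : comNzRingType) (g : {rmorphism R -> S}) c d w :
  curve_equations c d w -> curve_equations (g c) (g d) (fun i => g (w i)).
Proof.
move=> [q s]; split=> [i j i' j' i6 j6 i'6 j'6 eij|].
  by rewrite -!rmorphM (q i j i' j').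
by rewrite -rmorphXn s !(rmorphD, rmorphN, rmorphM).
Qed.

Lemma equations_rmorph_inj (R S : comNzRingType) (g : {rmorphism R -> S}) c d w :
    injective g ->
  curve_equations (g c) (g d) (fun i => g (w i)) -> curve_equations c d w.
Proof.
move=> g_inj [q s]; split=> [i j i' j' i6 j6 i'6 j'6 eij|]; apply: g_inj.
  by rewrite !rmorphM (q i j i' j').
by rewrite rmorphXn s !(rmorphD, rmorphN, rmorphM).
Qed.

Lemma equations_hyper_coords (K : fieldType) (a b : K) w :
    curve_equations a b w -> w 'o_0 != 0 ->
  exists u v : K, v ^+ 2 = (branch_poly a b).[u] /\
    forall i, w i = w 'o_0 * hyper_coords u v i.
Proof.
move=> [q s] w0; exists (w 'o_1 / w 'o_0), (w 'o_6 / w 'o_0).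
have w1E : w 'o_1 = w 'o_0 * (w 'o_1 / w 'o_0) by rewrite mulrCA mulfV ?mulr1.
have w6E : w 'o_6 = w 'o_0 * (w 'o_6 / w 'o_0) by rewrite mulrCA mulfV ?mulr1.
move: (w 'o_1 / _) (w 'o_6 / _) w1E w6E => u v w1E w6E.
have wE i : w i = w 'o_0 * hyper_coords u v i.
  rewrite /hyper_coords; case: ifP => [i6|]; last first.
    case: i => -[|[|[|[|[|[|[|m]]]]]]] // lt_m _.
    by rewrite -w6E; congr (w _); apply: val_inj.
  case: i i6 => m lt_m; elim: m lt_m => [|m IHm] lt_m /= m6.
    by rewrite expr0 mulr1; congr (w _); apply: val_inj.
  have lt_m' : (m < 7)%N by apply: ltnW.
  apply: (mulfI w0); rewrite (q _ _ 'o_1 (Ordinal lt_m')) //.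
  by rewrite w1E IHm ?(ltnW m6) //= exprS -mulrA [u * (_ * _)]mulrCA.
split=> //; apply: (mulfI (expf_neq0 2 w0)); rewrite horner_branch_poly.
move: s; rewrite (wE 'o_6) (wE 'o_5) (wE 'o_4) (wE 'o_1) /hyper_coords /= => s.
by rewrite -exprMn s; ring.
Qed.

Lemma mpoly_map_scale (k : fieldType) (n m d : nat) (F : 'I_m.+1 -> {mpoly k[n.+1]})
    (c : k) v : (forall j, F j \is d.-homog) ->
  mpoly_map F (c *: v) = c ^+ d *: mpoly_map F v.
Proof.
move=> Fh; apply/rowP=> j; rewrite !mxE -(mmap_homog _ _ _ (Fh j)).
by apply: eq_mmap => // i; rewrite mxE.
Qed.

Lemma mpoly_map_neq0 (k : fieldType) (n m d : nat) (F : 'I_m.+1 -> {mpoly k[n.+1]})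
    P v w : (forall j, F j \is d.-homog) -> hcoords P v -> hcoords P w ->
  mpoly_map F v != 0 -> mpoly_map F w != 0.
Proof.
move=> Fh Pv Pw; have [c _ ->] := hcoords_scale Pw Pv.
by rewrite (mpoly_map_scale _ _ Fh); apply: contra_neq => ->; rewrite scaler0.
Qed.

Section LocalCharts.
Variables (k : closedFieldType) (f : odd_degree_poly k).
Variables (K : fieldType) (iota : {rmorphism k -> K}) (x y : K).
Local Notation "A ^i" := (map_poly iota A) (at level 2, format "A ^i").
Hypothesis yE : y ^+ 2 = (f^i).[x].
Hypothesis x_transc : forall c, x != iota c.
Variables (a b : k) (u v : K).
Hypothesis vE : v ^+ 2 = ((branch_poly a b)^i).[u].

(** If T_0 does not vanish at the point, u = T_1/T_0 and v = T_6/T_0 are regular there.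
If it does, the image is the point at infinity, T_5 does not vanish, and 1/u = T_4/T_5
and v/u^5 = T_6/T_5 are regular. *)
Lemma maps_into_curve_at (T : 'I_7 -> coord_ring f) r c e
    (pE : e ^+ 2 = (map_poly idfun f).[c]) i0 :
    r != 0 -> (forall i, coord_eval yE (T i) = r * hyper_coords u v i) ->
    coord_eval pE (T i0) != 0 ->
  (exists a b, has_value yE pE u a /\ has_value yE pE v b) \/
  (exists a b, has_value yE pE u^-1 a /\ has_value yE pE (v / u ^+ 5) b).
Proof.
move=> r0 TE Ti0.
have eqT : curve_equations (coord_const f a) (coord_const f b) T.
  apply: (equations_rmorph_inj (g := coord_eval yE)); first exact: coord_eval_inj.
  rewrite /= !coord_eval_const.
  have eq_uv : curve_equations (iota a) (iota b) (fun i => r * hyper_coords u v i).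
    by apply/scale_equations/hyper_coords_equations; rewrite vE map_branch_poly.
  by case: eq_uv => q s; split=> [i j i' j' *|]; rewrite !TE //; apply: q.
have := rmorph_equations (coord_eval pE) eqT.
rewrite /= !coord_eval_const => eqp.
have [T0|T0] := eqVneq (coord_eval pE (T 'o_0)) 0; [right|left].
  have T5 : coord_eval pE (T 'o_5) != 0.
    apply: contraNneq Ti0 => T5; have [->|i5] := eqVneq i0 'o_5; first by rewrite T5.
    by rewrite (curve_equations_infinity eqp T0).
  have u0 : u != 0.
    apply: contraNneq T5 => u0.
    suff -> : T 'o_5 = 0 by rewrite rmorph0.
    apply: (coord_eval_inj (yE := yE)) => //.
    by rewrite TE rmorph0 /hyper_coords /= u0 expr0n mulr0.
  exists (coord_eval pE (T 'o_4) / coord_eval pE (T 'o_5)).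
  exists (coord_eval pE (T 'o_6) / coord_eval pE (T 'o_5)); split.
    exists (T 'o_5), (T 'o_4); split; rewrite ?divfK // !TE /hyper_coords /=.
    by field; rewrite u0.
  exists (T 'o_5), (T 'o_6); split; rewrite ?divfK // !TE /hyper_coords /=.
  by field; rewrite u0.
exists (coord_eval pE (T 'o_1) / coord_eval pE (T 'o_0)).
exists (coord_eval pE (T 'o_6) / coord_eval pE (T 'o_0)); split.
  exists (T 'o_0), (T 'o_1); split; rewrite ?divfK // !TE /hyper_coords /=; ring.
exists (T 'o_0), (T 'o_6); split; rewrite ?divfK // !TE /hyper_coords /=; ring.
Qed.

End LocalCharts.

Section Forward.
Variables (k : closedFieldType) (a1 b1 a2 b2 : k).
Hypothesis two_neq0 : 2 != 0 :> k.
Hypotheses (a1_neq0 : a1 != 0) (b1_neq0 : b1 != 0).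
Hypotheses (a2_neq0 : a2 != 0) (b2_neq0 : b2 != 0) (ab2 : a2 != b2).
Local Notation f := (branch_odd_poly a1 b1_neq0).
Local Notation f' := (branch_odd_poly b1 a1_neq0).
Local Notation X := (@hyperelliptic_curve k 4 (branch_poly a1 b1)).
Local Notation Y := (@hyperelliptic_curve k 4 (branch_poly a2 b2)).
Variables phi psi : proj_space k 6 -> proj_space k 6.
Hypothesis phi_reg : regular_on X phi.
Hypothesis psi_reg : regular_on Y psi.
Hypothesis phiXY : forall P, X P -> Y (phi P).
Hypothesis psiK : forall P, X P -> psi (phi P) = P.

Local Notation represents := (represents a1 b1 phi).
Local Notation forms := (@affine_forms k a1 b1 b1_neq0).

(** Otherwise phi would map all affine points where the remaining form does not vanish
to the point at infinity, whereas it is injective. *)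
Lemma affine_forms_first_neq0 F i : represents F -> forms F i != 0 ->
  forms F 'o_0 != 0.
Proof.
move=> repF Fi0; apply/eqP=> F0.
have eqF := affine_forms_equations b1_neq0 phiXY repF.
have pt c e (pE : e ^+ 2 = (map_poly idfun f).[c]) j : j != 'o_5 ->
    coord_eval pE (forms F j) = 0.
  have := rmorph_equations (coord_eval pE) eqF; rewrite /= !coord_eval_const => eqp.
  by apply: (curve_equations_infinity eqp); rewrite F0 rmorph0.
have Fj0 j : j != 'o_5 -> forms F j = 0.
  by move=> j5; apply: coord_vanish => c e pE; rewrite pt.
have F5 : forms F 'o_5 != 0.
  by apply: contraNneq Fi0 => F5; have [->|/Fj0->] := eqVneq i 'o_5; rewrite ?F5.
have F5pt c : ~~ root (coord_norm (forms F 'o_5)) c ->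
    exists e P, [/\ X P, hcoords P (\row_i hyper_coords c e i)
      & hcoords (phi P) (\row_i (i == 'o_5)%:R)].
  move=> rc; have [e pE] := point_exists f c; have [P XP Pv] := affine_point pE.
  exists e, P; split=> //.
  have F5v : coord_eval pE (forms F 'o_5) != 0.
    apply: contraNneq rc => F5v; rewrite /root.
    by have := coord_eval_norm pE (forms F 'o_5); rewrite F5v mul0r map_poly_id // => <-.
  have Fv : mpoly_map F (\row_i hyper_coords c e i) =
      coord_eval pE (forms F 'o_5) *: \row_i (i == 'o_5)%:R.
    apply/rowP=> j; rewrite -(eval_affine_forms F j pE) !mxE.
    by have [->|/pt->] := eqVneq j 'o_5; rewrite ?mulr1 ?mulr0.
  have /(scale_hcoords (_ : (coord_eval pE (forms F 'o_5))^-1 != 0)) : hcoords (phi P)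
      (coord_eval pE (forms F 'o_5) *: \row_i (i == 'o_5)%:R).
    rewrite -Fv; apply: repF => //; rewrite Fv.
    apply/eqP=> /rowP/(_ 'o_5); rewrite !mxE eqxx mulr1 => /eqP.
    by rewrite (negPf F5v).
  by rewrite scalerA mulVf // scale1r; apply; rewrite invr_eq0.
have N0 : coord_norm (forms F 'o_5) != 0 by rewrite coord_norm_eq0.
have [c rc] := closed_nonrootP _ N0.
have [|c' ] := closed_nonrootP (coord_norm (forms F 'o_5) * ('X - c%:P)) _.
  by rewrite mulf_neq0 // polyXsubC_eq0.
rewrite rootM negb_or root_XsubC => /andP[rc' cc'].
have [e [P [XP Pv phiP]]] := F5pt c rc.
have [e' [P' [XP' P'v phiP']]] := F5pt c' rc'.
have PP' : P = P' by rewrite -(psiK XP) -(psiK XP') (hcoords_uniq phiP phiP').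
rewrite -PP' in P'v; have [r r0 /rowP rE] := hcoords_scale Pv P'v.
have := rE 'o_0; have := rE 'o_1; rewrite !mxE /hyper_coords /= !expr0 !expr1 mulr1.
by move=> e1 e0; rewrite e1 -e0 mul1r eqxx in cc'.
Qed.

Section Coordinates.
Variables (K : fieldType) (iota : {rmorphism k -> K}) (x y : K).
Local Notation "A ^i" := (map_poly iota A) (at level 2, format "A ^i").
Hypothesis yE : y ^+ 2 = (f^i).[x].
Hypothesis x_transc : forall c, x != iota c.
Local Notation ev := (coord_eval yE).

Let ev_inj : injective ev. Proof. exact: coord_eval_inj. Qed.

Let ev_neq0 p : p != 0 -> ev p != 0.
Proof. by apply: contra_neq => p0; apply: ev_inj; rewrite p0 rmorph0. Qed.

(** Here u and v are the pullbacks of the affine coordinates. They do not depend on the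
family of forms: around any point, the forms describing phi are proportional to
(1, u, ..., u^5, v). *)
Lemma generic_image F i : represents F -> forms F i != 0 ->
  exists u v : K, v ^+ 2 = ((branch_poly a2 b2)^i).[u] /\
    forall F' j, represents F' ->
      ev (forms F' j) = ev (forms F' 'o_0) * hyper_coords u v j.
Proof.
move=> repF Fi0.
have F0 : ev (forms F 'o_0) != 0 by apply/ev_neq0/(affine_forms_first_neq0 repF Fi0).
have := rmorph_equations ev (affine_forms_equations b1_neq0 phiXY repF).
rewrite /= !coord_eval_const => eqF.
have [u [v [vE FE]]] := equations_hyper_coords eqF F0.
exists u, v; split=> [|F' j repF']; first by rewrite map_branch_poly.
have := affine_forms_proportional b1_neq0 j 'o_0 repF' repF.
move: (forms F' j) (forms F' 'o_0) (forms F j) (forms F 'o_0) F0 (FE j) => a b c d d0 cE.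
by move/(congr1 ev); rewrite !rmorphM /= cE mulrA mulrAC; apply: mulIf.
Qed.

Variables u v : K.
Hypothesis vE : v ^+ 2 = ((branch_poly a2 b2)^i).[u].
Hypothesis formsE : forall F j, represents F ->
  ev (forms F j) = ev (forms F 'o_0) * hyper_coords u v j.

Lemma maps_into_curve_affine : maps_into_curve yE u v.
Proof.
move=> c e pE; have [P XP Pv] := affine_point pE.
have [d [F [Fh [w Pw Fw] repF]]] := phi_reg XP.
have /rV0Pn[i] := mpoly_map_neq0 Fh Pw Pv Fw.
rewrite -(eval_affine_forms F i pE) => Fi.
have Fi0 : forms F i != 0 by apply: contraNneq Fi => ->; rewrite rmorph0.
have r0 := ev_neq0 (affine_forms_first_neq0 repF Fi0).
exact: (maps_into_curve_at x_transc vE r0 (fun j => formsE j repF) Fi).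
Qed.

(** By homogeneity, restricting a form of degree d to the chart at infinity multiplies
its restriction to the affine chart by x^(-5d), so proportionality is preserved. *)
Lemma maps_into_curve_infty :
  maps_into_curve (chart_infty_eq a1_neq0 yE x_transc) u v.
Proof.
have x0 : x != 0 by rewrite -(rmorph0 iota).
move=> c e pE; have [P XP Pv] := infinity_point b1_neq0 pE.
have [d [F [Fh [w Pw Fw] repF]]] := phi_reg XP.
have /rV0Pn[i] := mpoly_map_neq0 Fh Pw Pv Fw; rewrite mxE.
pose T j := restrict_form (infty_coords (coord_x f') (coord_y f')) (F j).
have -> : (F i).@[(\row_i infty_coords c e i) 0] = coord_eval pE (T i).
  rewrite eval_restrict_form; apply: eq_mmap => // l.
  by rewrite mxE rmorph_infty_coords /= coord_eval_x coord_eval_y.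
move=> Ti.
have TE j : coord_eval (chart_infty_eq a1_neq0 yE x_transc) (T j) =
    (x^-1 ^+ 5) ^+ d * ev (forms F 'o_0) * hyper_coords u v j.
  rewrite -mulrA -(formsE j repF) !eval_restrict_form -(mmap_homog _ _ _ (Fh j)).
  apply: eq_mmap => // l.
  rewrite rmorph_infty_coords rmorph_hyper_coords /= !coord_eval_x !coord_eval_y.
  rewrite infty_coordsE ?invr_eq0 // invrK; congr (_ * hyper_coords _ _ _).
  by rewrite exprVn invrK divfK // expf_neq0.
apply: (maps_into_curve_at (chart_infty_transc x_transc) vE _ TE Ti).
apply: contraNneq Ti => r0; suff -> : T i = 0 by rewrite rmorph0.
apply: (coord_eval_inj (chart_infty_transc x_transc)
  (yE := chart_infty_eq a1_neq0 yE x_transc)).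
by rewrite TE r0 mul0r rmorph0.
Qed.

(** The forms describing psi around an image point recover x. They are composed with the
forms F of phi; the factor F_0 discards the points where these might all vanish. *)
Lemma coordinate_recovered F i c e (pE : e ^+ 2 = (map_poly idfun f).[c]) :
    represents F -> coord_eval pE (forms F i) != 0 ->
  exists H0 H1 : {mpoly k[7]}, let m := mmap iota (hyper_coords u v) in
    m H0 != 0 /\ x = m H1 / m H0.
Proof.
move=> repF Fi; have [P XP Pv] := affine_point pE.
have Fi0 : forms F i != 0 by apply: contraNneq Fi => ->; rewrite rmorph0.
have F0 := affine_forms_first_neq0 repF Fi0.
have FP : mpoly_map F (\row_i hyper_coords c e i) != 0.
  by apply/rV0Pn; exists i; rewrite -(eval_affine_forms F i pE).
have phiP := repF _ _ XP Pv FP.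
have [d [H [Hh [w Pw Hw] repH]]] := psi_reg (phiXY XP).
have HP := mpoly_map_neq0 Hh Pw phiP Hw.
pose HF j := mmap (coord_const f) (forms F) (H j).
have HFE c' e' (p'E : e' ^+ 2 = (map_poly idfun f).[c']) j : coord_eval p'E (HF j) =
    mpoly_map H (mpoly_map F (\row_i hyper_coords c' e' i)) 0 j.
  rewrite [LHS]rmorph_mmap [RHS]mxE; apply: eq_mmap => [a|l] /=.
    by rewrite coord_eval_const.
  exact: eval_affine_forms.
have HF1 : forms F 'o_0 * HF 'o_1 = forms F 'o_0 * (coord_x f * HF 'o_0).
  apply/eqP; rewrite -subr_eq0; apply/eqP.
  apply: coord_vanish => c' e' p'E; have [Q XQ Qv] := affine_point p'E.
  have := HFE _ _ p'E 'o_0; have := HFE _ _ p'E 'o_1.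
  have := eval_affine_forms F 'o_0 p'E; move: (HF 'o_0) (HF 'o_1) (forms F 'o_0).
  move=> h0 h1 g0 e0 e2 e1; rewrite rmorphB !rmorphM /= coord_eval_x e0 e1 e2.
  have := repF _ _ XQ Qv; move: (mpoly_map F _) => g repg.
  have [->|gN0] := eqVneq g 0; first by rewrite [(0 : 'rV_7) 0 _]mxE !mul0r subrr.
  have [->|hN0] := eqVneq (mpoly_map H g) 0; first by rewrite !mxE !mulr0 subrr.
  have := repH _ _ (phiXY XQ) (repg gN0) hN0.
  rewrite (psiK XQ) => /(hcoords_scale Qv)[r _ ->].
  by rewrite !mxE /hyper_coords /=; ring.
have HF0 : HF 'o_0 != 0.
  have := repH _ _ (phiXY XP) phiP HP; rewrite (psiK XP).
  case/(hcoords_scale Pv) => r r0 hE.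
  apply: contraNneq r0 => h0; have := HFE _ _ pE 'o_0.
  by rewrite h0 rmorph0 hE !mxE /hyper_coords /= mulr1 => <-.
exists (H 'o_0), (H 'o_1) => m.
have evF0 := ev_neq0 F0.
have evHF j : ev (HF j) = ev (forms F 'o_0) ^+ d * m (H j).
  rewrite [LHS]rmorph_mmap -(mmap_homog _ _ _ (Hh j)); apply: eq_mmap => [a|l] /=.
    exact: coord_eval_const.
  exact: formsE.
have m0 : m (H 'o_0) != 0.
  by have := ev_neq0 HF0; rewrite evHF; apply: contra_neq => ->; rewrite mulr0.
split=> //; apply: (mulIf m0); rewrite divfK //.
apply: (mulfI (expf_neq0 d evF0)); rewrite mulrCA -!evHF.
by rewrite (mulfI F0 HF1) rmorphM /= coord_eval_x.
Qed.

Variable D : K -> K.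
Hypothesis D_der : derivation_over iota D.
Hypothesis Dx : D x = y *+ 2.

(** If D u = 0 then D v = 0, since v^2 is a polynomial in u, and then D x = 0, since x is
rational in u and v; but D x = 2y. *)
Lemma isomorphism_separable F i c e (pE : e ^+ 2 = (map_poly idfun f).[c]) :
  represents F -> coord_eval pE (forms F i) != 0 -> D u != 0.
Proof.
move=> repF Fi; have [H0 [H1 [m0 xE]]] := coordinate_recovered repF Fi.
apply/eqP=> Du.
have two0 : 2 != 0 :> K by rewrite -(rmorph_nat iota) fmorph_eq0.
have Dv : D v = 0.
  have := congr1 D vE; rewrite (der_poly D_der) Du mulr0 (derX D_der) => /eqP.
  rewrite -mulr_natr mulf_eq0 (negPf two0) orbF mulf_eq0 => /orP[/eqP//|].
  by rewrite expr1 => /eqP->; rewrite (der0 D_der).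
have Dm H : D (mmap iota (hyper_coords u v) H) = 0.
  apply: (der_mmap_eq0 D_der) => j; rewrite /hyper_coords; case: ifP => // _.
  by case: (val j) => [|l]; rewrite ?(der1 D_der) // (derX D_der) Du mul0r mul0rn.
have /eqP : D x = 0 by rewrite xE (der_div D_der) // !Dm !(mul0r, mulr0) subr0 mul0r.
rewrite Dx -mulr_natr mulf_eq0 (negPf two0) orbF => /eqP y0.
have := yE; rewrite y0 expr0n => /esym/(horner_transc_eq0 x_transc).
move/(congr1 (size \o @polyseq k)) => /=.
by rewrite size_branch_poly // size_poly0.
Qed.

End Coordinates.

Lemma isomorphism_moebius : exists al be ga et c : k,
  [/\ al * et != be * ga, c != 0 &
    branch_form a2%:P b2%:P (al *: 'X + be%:P) (ga *: 'X + et%:P) =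
      c *: branch_poly a1 b1].
Proof.
have [K [iota [x [y [D [yE x_transc D_der Dx Dy]]]]]] := function_field_exists f.
have [e pE] := point_exists f 0; have [P XP Pv] := affine_point pE.
have [d [F [Fh [w Pw Fw] repF]]] := phi_reg XP.
have /rV0Pn[i] := mpoly_map_neq0 Fh Pw Pv Fw.
rewrite -(eval_affine_forms F i pE) => Fi.
have Fi0 : forms F i != 0 by apply: contraNneq Fi => ->; rewrite rmorph0.
have [u [v [vE formsE]]] := generic_image yE x_transc repF Fi0.
have Du0 := isomorphism_separable x_transc vE formsE D_der Dx repF Fi.
apply: (moebius_of_maps_into_curve two_neq0 D_der Dx Dy a2_neq0 b2_neq0 ab2 Du0 vE).
  exact: maps_into_curve_affine.
exact: maps_into_curve_infty.
Qed.

End Forward.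

(** * Diagonal maps, and the theorem *)

Section DiagonalMaps.
Variables (k : fieldType) (n : nat).
Implicit Types (s : 'I_n.+1 -> k) (v : 'rV[k]_n.+1) (A B : proj_space k n -> Prop).

Definition diag_row s v : 'rV[k]_n.+1 := \row_i (s i * v 0 i).

(** When all s i are nonzero, this is the image of the line P, whichever generator is
used ([diag_map_hcoords]). *)
Definition diag_map s (P : proj_space k n) : proj_space k n :=
  insubd P (<[diag_row s (vpick (val P))]>%VS).

Lemma diag_row_scale s c v : diag_row s (c *: v) = c *: diag_row s v.
Proof. by apply/rowP=> i; rewrite !mxE mulrCA. Qed.

Lemma diag_row_neq0 s v : (forall i, s i != 0) -> v != 0 -> diag_row s v != 0.
Proof.
by move=> s0 /rV0Pn[i vi]; apply/rV0Pn; exists i; rewrite mxE mulf_neq0.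
Qed.

Lemma diag_map_hcoords s P v : (forall i, s i != 0) ->
  hcoords P v -> hcoords (diag_map s P) (diag_row s v).
Proof.
move=> s0 Pv; have Ppick := hcoords_vpick P.
have [c c0 e] := hcoords_scale Pv Ppick.
have dP : hcoords (diag_map s P) (diag_row s (vpick (val P))).
  have pick0 := hcoords_neq0 Ppick.
  by rewrite /hcoords /diag_map val_insubd /= dim_vline diag_row_neq0.
have := scale_hcoords (_ : c^-1 != 0) dP.
by rewrite -diag_row_scale e scalerA mulVf // scale1r; apply; rewrite invr_eq0.
Qed.

Lemma diag_mapK s s' P : (forall i, s' i * s i = 1) ->
  diag_map s' (diag_map s P) = P.
Proof.
move=> ss'; have s0 i : s i != 0 by apply: contra_eq_neq (ss' i) => ->; rewrite mulr0 eq_sym oner_neq0.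
have s'0 i : s' i != 0 by apply: contra_eq_neq (ss' i) => ->; rewrite mul0r eq_sym oner_neq0.
have Pv := hcoords_vpick P; have dP := diag_map_hcoords s0 Pv.
apply: (hcoords_uniq (diag_map_hcoords s'0 dP)).
suff -> : diag_row s' (diag_row s (vpick (val P))) = vpick (val P) by [].
by apply/rowP=> i; rewrite !mxE mulrA ss' mul1r.
Qed.

(** The form F composed with [diag_row s]. *)
Definition diag_form s (F : {mpoly k[n.+1]}) : {mpoly k[n.+1]} :=
  \sum_(m <- msupp F) (F@_m * mmap1 s m) *: 'X_[m].

Lemma diag_form_homog s d F : F \is d.-homog -> diag_form s F \is d.-homog.
Proof.
move=> /dhomogP Fd; rewrite /diag_form big_seq rpred_sum // => m mF.
by rewrite rpredZ // dhomogX; apply/eqP/Fd.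
Qed.

Lemma meval_diag_form s F v : (diag_form s F).@[v 0] = F.@[diag_row s v 0].
Proof.
rewrite /diag_form [LHS]rmorph_sum [RHS]/meval /mmap; apply: eq_bigr => m _ /=.
rewrite mevalZ mevalX -mulrA; congr (_ * _); rewrite /mmap1 -big_split /=.
by apply: eq_bigr => i _; rewrite mxE exprMn.
Qed.

(** Composition with a diagonal map preserves forms of each degree, so diagonal maps are
continuous for the Zariski topology. *)
Lemma diag_map_closure s A B P : (forall i, s i != 0) ->
    (forall Q, A Q -> B (diag_map s Q)) ->
  proj_closure A P -> proj_closure B (diag_map s P).
Proof.
move=> s0 AB AP d F Fd FB.
have Pv := hcoords_vpick P.
refine (hcoords_vanish Fd (diag_map_hcoords s0 Pv) _).
rewrite -meval_diag_form; apply: (AP d _ (diag_form_homog s Fd)) Pv => Q AQ w Qw.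
rewrite meval_diag_form; apply: (FB _ (AB _ AQ)); exact: diag_map_hcoords.
Qed.

Lemma diag_map_regular s A : (forall i, s i != 0) -> regular_on A (diag_map s).
Proof.
move=> s0 P _; exists 1%N, (fun j => s j *: 'X_j).
have diagE v : mpoly_map (fun j => s j *: 'X_j) v = diag_row s v.
  by apply/rowP=> j; rewrite !mxE mevalZ mevalXU.
split=> [j||Q v _ Qv _].
- by rewrite rpredZ // dhomogX /= mdeg1.
- have Pv := hcoords_vpick P.
  by exists (vpick (val P)) => //; rewrite diagE diag_row_neq0 // (hcoords_neq0 Pv).
- by rewrite diagE; apply: diag_map_hcoords.
Qed.

Lemma diag_isomorphic s s' A B : (forall i, s' i * s i = 1) ->
    (forall Q, A Q -> B (diag_map s Q)) ->
    (forall Q, B Q -> A (diag_map s' Q)) ->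
  isomorphic (proj_closure A) (proj_closure B).
Proof.
move=> ss' AB BA.
have s0 i : s i != 0 by apply: contra_eq_neq (ss' i) => ->; rewrite mulr0 eq_sym oner_neq0.
have s'0 i : s' i != 0 by apply: contra_eq_neq (ss' i) => ->; rewrite mul0r eq_sym oner_neq0.
exists (diag_map s), (diag_map s'); split.
- by split; apply: diag_map_regular.
- by move=> P; apply: diag_map_closure.
- by move=> P; apply: diag_map_closure.
- by move=> P _; apply: diag_mapK.
- by move=> P _; apply: diag_mapK => i; rewrite mulrC.
Qed.

End DiagonalMaps.

Lemma H_curve_poly (k : fieldType) (l : k) :
  'X * ('X^4 - 1) * ('X^4 - l%:P) = branch_poly l 1.
Proof. by rewrite /branch_poly -!mul_polyC polyCD; ring. Qed.

(** The map (x, y) -> (c x, e y) is induced by the diagonal map with entries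
(1, c, ..., c^5, e). *)
Lemma scaling_isomorphic (k : fieldType) (l1 l2 c e : k) : c != 0 -> e != 0 ->
    (forall x, e ^+ 2 * (branch_poly l1 1).[x] = (branch_poly l2 1).[c * x]) ->
  isomorphic (H_curve l1) (H_curve l2).
Proof.
move=> c0 e0 ce; rewrite /H_curve !H_curve_poly.
have aff l l' (c' e' : k) : c' != 0 -> e' != 0 ->
    (forall x, e' ^+ 2 * (branch_poly l 1).[x] = (branch_poly l' 1).[c' * x]) ->
    forall Q, @affine_hyperelliptic k 4 (branch_poly l 1) Q ->
      @affine_hyperelliptic k 4 (branch_poly l' 1) (diag_map (hyper_coords c' e') Q).
  move=> c'0 e'0 ce' Q [x [y [xy Qv]]]; exists (c' * x), (e' * y).
  split; first by rewrite exprMn xy ce'.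
  have s0 i : hyper_coords c' e' i != 0 by rewrite /hyper_coords; case: ifP; rewrite ?expf_neq0.
  have := diag_map_hcoords s0 Qv; congr hcoords; apply/rowP=> i.
  by rewrite !mxE /hyper_coords; case: ifP => // _; rewrite exprMn.
apply: (@diag_isomorphic _ _ (hyper_coords c e) (hyper_coords c^-1 e^-1)).
- by move=> i; rewrite /hyper_coords; case: ifP; rewrite ?exprVn mulVf ?expf_neq0.
- exact: aff.
- apply: aff; rewrite ?invr_eq0 // => x.
  by rewrite -[x in LHS](mulVKf c0) -ce exprVn mulKf ?expf_neq0.
Qed.

Theorem proposition3p2p4 (k : closedFieldType) (p : nat)
    (charp : p \in [pchar k]) (p_ge7 : (7 <= p)%N)
    (lambda1 lambda2 : k)
    (lambda1_neq0 : lambda1 != 0) (lambda1_neq1 : lambda1 != 1)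
    (lambda2_neq0 : lambda2 != 0) (lambda2_neq1 : lambda2 != 1) :
  isomorphic (H_curve lambda1) (H_curve lambda2) <->
  lambda1 = lambda2 \/ lambda1 = 1 / lambda2.
Proof.
have small m : (0 < m < 7)%N -> m%:R != 0 :> k.
  case/andP=> m0 m7; rewrite -(dvdn_pcharf charp) gtnNdvd //.
  exact: leq_trans m7 p_ge7.
split=> [[phi [psi [[phi_reg psi_reg] phiXY _ psiK _]]]|].
  rewrite /H_curve !H_curve_poly in phi_reg psi_reg phiXY psiK.
  have [al [be [ga [et [c [det c0 eF]]]]]] := isomorphism_moebius (small 2 isT)
    lambda1_neq0 (oner_neq0 k) lambda2_neq0 (oner_neq0 k) lambda2_neq1
    phi_reg psi_reg phiXY psiK.
  exact: (branch_form_equiv (small 2 isT) (small 3 isT) (small 5 isT)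
    lambda2_neq0 det c0 eF).
case=> [->|l12].
  apply: (@scaling_isomorphic _ _ _ 1 1); rewrite ?oner_neq0 // => x.
  by rewrite expr1n !mul1r.
(* A scaling by a fourth root of lambda2 sends the branch points 1 and
   1 / lambda2 of x ^+ 4 to lambda2 and 1. *)
have [c c4] := closed_field_root lambda2 (isT : 0 < 4)%N.
have [e e2] := closed_field_root (c * lambda2 ^+ 2) (isT : 0 < 2)%N.
have c0 : c != 0 by apply: contraNneq lambda2_neq0 => c0; rewrite -c4 c0 expr0n.
have e0 : e != 0.
  by rewrite -sqrf_eq0 e2 mulf_neq0 // expf_neq0.
apply: (scaling_isomorphic c0 e0) => x; rewrite e2 l12 !horner_branch_poly -c4.
by field.
Qed.
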